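(* Let $\exp^*\in\mathsf{G}_{\operatorname{PreLie}}$ be the element corresponding to $\sum_{k\ge1}\frac{v^{\leftarrow k}}{k!}$ in the completed free pre-Lie algebra on one generator $v$, let $\log^*$ be its inverse in the group $\mathsf{G}_{\operatorname{PreLie}}$, and let $\psi:\mathsf{G}_{\operatorname{PreLie}}\to\mathsf{G}_{\operatorname{Mu}}$ be the group morphism induced by the quotient map of operads $\operatorname{PreLie}\to\operatorname{Mu}$. Identifying $\mathsf{G}_{\operatorname{Mu}}$ with $\mathbb{Q}^*\ltimes(1+x\mathbb{Q}[[x]])$, the image of $\exp^*$ by $\psi$ is $\left(1,\frac{\exp x-1}{x}\right)$ and the image of $\log^*$ by $\psi$ is $\left(1,\frac{x}{\exp x-1}\right)$.
   Context: Groups attached to operads. An augmented operad is a (symmetric, unital) operad $\mathcal{P}$ in $\mathbb{Q}$-vector spaces with $\mathcal{P}(0)=\{0\}$ and $\mathcal{P}(1)=\mathbb{Q}e$, where $e$ is the unit. Let $\gamma$ be its composition map, $\langle\,\cdot\,\rangle$ the quotient map to coinvariants $\mathcal{P}(n)_{\mathfrak{S}_n}$, and $\widehat{\mathcal{P}}=\prod_{n\ge1}\mathcal{P}(n)_{\mathfrak{S}_n}$. For $x=\sum_m x_m$, $y=\sum_n y_n$ in $\widehat{\mathcal{P}}$ with representatives $\bar{x}_m,\bar{y}_n$ of their components in $\mathcal{P}$, put $$x\times y=\sum_{m\ge1}\ \sum_{n_1,\dots,n_m\ge1}\langle\gamma(\bar{x}_m,\bar{y}_{n_1},\dots,\bar{y}_{n_m})\rangle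 .$$ This makes $\widehat{\mathcal{P}}$ an associative monoid with unit the image of $e$, and $\mathsf{G}_{\mathcal{P}}$ is its group of invertible elements. A morphism of augmented operads induces a group morphism on the $\mathsf{G}$'s. The operad $\operatorname{PreLie}$. $\operatorname{PreLie}(n)$ has basis the rooted trees with vertices labeled bijectively by $\{1,\dots,n\}$ (and $\operatorname{PreLie}(0)=0$); edges are oriented towards the root. The composition of a labeled tree $S$ at the vertex $i$ of a labeled tree $T$ is $T\circ_i S=\sum_f T\circ_i^f S$, over all maps $f$ from the incoming edges of $i$ in $T$ to the vertices of $S$, where $T\circ_i^fS$ is obtained by replacing $i$ by $S$ and grafting back the subtrees of $T$ attached to $i$ according to $f$. Hence $\operatorname{PreLie}(n)_{\mathfrak{S}_n}$ has basis the unlabeled rooted trees with $n$ vertices, and $\bigoplus_n\operatorname{PreLie}(n)_{\mathfrak{S}_n}$ is identified with the free pre-Lie algebra on one generator $v$ (the one-vertex tree), with pre-Lie product $S\leftarrow T$ equal to the sum, over vertices $s$ of $S$, of the trees obtained by grafting the root of $T$ onto $s$ by a new edge. Here $v^{\leftarrow k}=((\cdots((v\leftarrow v)\leftarrow v)\cdots)\leftarrow v)$ with $k$ factors. The operad $\operatorname{Mu}$. A corolla is a rooted tree in which every chain of adjacent vertices starting at the root has at most two vertices. The labeled trees that are not corollas span an operadic ideal of $\operatorname{PreLie}$, and $\operatorname{Mu}$ is the quotient operad. The space $\operatorname{Mu}(n)_{\mathfrak{S}_n}$ is one-dimensional with basis $\nu_{n-1}$, the image of the corolla with $n$ vertices.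 Every element of $\mathsf{G}_{\operatorname{Mu}}$ can be written uniquely as $\lambda\sum_{m\ge0}f_m\nu_m$ with $\lambda\in\mathbb{Q}^*$ and $f_0=1$, and $\lambda\sum_m f_m\nu_m\mapsto(\lambda,\sum_m f_mx^m)$ is an isomorphism from $\mathsf{G}_{\operatorname{Mu}}$ to the semi-direct product $\mathbb{Q}^*\ltimes(1+x\mathbb{Q}[[x]])$ with product $(\lambda,f(x))(\theta,g(x))=(\lambda\theta,f(\theta x)g(x))$; this is the identification used in the claim. *)

(* Defs.v *)
From HB Require Import structures.
From mathcomp Require Import all_boot all_order all_algebra perm.
From mathcomp Require Import boolp.

Set Implicit Arguments.
Unset Strict Implicit.
Unset Printing Implicit Defensive.

Import GRing.Theory.
Local Open Scope ring_scope.
Local Open Scope quotient_scope.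

Section Quotient.
Variables (V : lmodType rat) (A : V -> Prop).

Definition in_span (x : V) : Prop :=
  exists2 s : seq (rat * V),
    (forall c, c \in s -> A c.2) & x = \sum_(c <- s) c.1 *: c.2.

Lemma in_span0 : in_span 0.
Proof. by exists [::] => //; rewrite big_nil. Qed.

Lemma in_spanD x y : in_span x -> in_span y -> in_span (x + y).
Proof.
move=> [s sA ->] [t tA ->]; exists (s ++ t); last by rewrite big_cat.
by move=> c; rewrite mem_cat => /orP [h|h]; [apply: sA|apply: tA].
Qed.

Lemma in_spanZ a x : in_span x -> in_span (a *: x).
Proof.
move=> [s sA ->]; exists [seq (a * c.1, c.2) | c <- s].
  by move=> _ /mapP [c cs ->]; exact: (sA _ cs).
by rewrite big_map scaler_sumr; apply: eq_bigr => c _; rewrite scalerA.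
Qed.

Lemma in_spanN x : in_span x -> in_span (- x).
Proof. by rewrite -scaleN1r; apply: in_spanZ. Qed.

Lemma in_span_gen x : A x -> in_span x.
Proof.
move=> Ax; exists [:: (1, x)]; last by rewrite big_seq1 scale1r.
by move=> c; rewrite inE => /eqP ->.
Qed.

Definition span_equiv (x y : V) : bool := `[< in_span (x - y) >].

Lemma span_equiv_is_equiv : equiv_class_of span_equiv.
Proof.
split=> [x|x y|y x z].
- by apply/asboolP; rewrite subrr; apply: in_span0.
- by apply/asboolP/asboolP => /in_spanN; rewrite opprB.
- move=> /asboolP xy /asboolP yz; apply/asboolP.
  by rewrite -[x](subrK y) -addrA; apply: in_spanD.
Qed.

Canonical span_equiv_equiv := EquivRelPack span_equiv_is_equiv.
Canonical span_equiv_encModRel := defaultEncModRel span_equiv.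

Definition lquot := {eq_quot span_equiv}.
HB.instance Definition _ := EqQuotient.on lquot.
HB.instance Definition _ := Choice.on lquot.

Definition cls (x : V) : lquot := \pi_lquot x.

Lemma clsP x y : cls x = cls y <-> in_span (x - y).
Proof. by split=> [/eqmodP/asboolP|h]; last exact/eqmodP/asboolP. Qed.

Lemma cls_repr (q : lquot) : cls (repr q) = q.
Proof. exact: reprK. Qed.

Definition lquot_add (p q : lquot) := cls (repr p + repr q).
Definition lquot_opp (p : lquot) := cls (- repr p).
Definition lquot_scale (a : rat) (p : lquot) := cls (a *: repr p).

Lemma repr_cls x : in_span (repr (cls x) - x).
Proof. by apply/clsP; rewrite cls_repr. Qed.

Lemma clsD_subproof x y : cls (x + y) = lquot_add (cls x) (cls y).
Proof.
apply/clsP; rewrite -opprB; apply: in_spanN.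
by rewrite opprD addrACA; apply: in_spanD; apply: repr_cls.
Qed.

Lemma clsN_subproof x : cls (- x) = lquot_opp (cls x).
Proof. by apply/clsP; rewrite opprK addrC; apply: repr_cls. Qed.

Lemma clsZ_subproof a x : cls (a *: x) = lquot_scale a (cls x).
Proof.
apply/clsP; rewrite -scalerBr -opprB scalerN.
by apply/in_spanN/in_spanZ/repr_cls.
Qed.

Lemma lquot_ind (Q : lquot -> Prop) : (forall x, Q (cls x)) -> forall q, Q q.
Proof. by move=> h q; rewrite -(cls_repr q). Qed.

Lemma lquot_addA : associative lquot_add.
Proof.
elim/lquot_ind=> x; elim/lquot_ind=> y; elim/lquot_ind=> z.
by rewrite -!clsD_subproof addrA.
Qed.

Lemma lquot_addC : commutative lquot_add.
Proof.
by elim/lquot_ind=> x; elim/lquot_ind=> y; rewrite -!clsD_subproof addrC.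
Qed.

Lemma lquot_add0 : left_id (cls 0) lquot_add.
Proof. by elim/lquot_ind=> x; rewrite -clsD_subproof add0r. Qed.

Lemma lquot_addN : left_inverse (cls 0) lquot_opp lquot_add.
Proof.
by elim/lquot_ind=> x; rewrite -clsN_subproof -clsD_subproof addNr.
Qed.

HB.instance Definition _ :=
  GRing.isZmodule.Build lquot lquot_addA lquot_addC lquot_add0 lquot_addN.

Lemma clsD x y : cls (x + y) = cls x + cls y.
Proof. exact: clsD_subproof. Qed.

Lemma lquot_scaleA a b q :
  lquot_scale a (lquot_scale b q) = lquot_scale (a * b) q.
Proof.
by elim/lquot_ind: q => x; rewrite -!clsZ_subproof scalerA.
Qed.

Lemma lquot_scale1 : left_id 1 lquot_scale.
Proof. by elim/lquot_ind=> x; rewrite -clsZ_subproof scale1r. Qed.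

Lemma lquot_scaleDr : right_distributive lquot_scale +%R.
Proof.
move=> a; elim/lquot_ind=> x; elim/lquot_ind=> y.
by rewrite -clsD -!clsZ_subproof scalerDr clsD.
Qed.

Lemma lquot_scaleDl q : {morph lquot_scale^~ q : a b / a + b}.
Proof.
move=> a b; elim/lquot_ind: q => x.
by rewrite -!clsZ_subproof scalerDl clsD.
Qed.

HB.instance Definition _ :=
  GRing.Zmodule_isLmodule.Build rat lquot
    lquot_scaleA lquot_scale1 lquot_scaleDr lquot_scaleDl.

Lemma cls_is_linear : linear cls.
Proof. by move=> a x y; rewrite clsD clsZ_subproof. Qed.

HB.instance Definition _ := GRing.isLinear.Build rat V lquot _ cls cls_is_linear.

End Quotient.

(* The structure maps of a symmetric unital operad; the axioms of operads play
   no role in the definitions below.  [op_comp a b n x y] is the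
   partial composition of y at the input number a + 1 (counting from 1) of an
   x with a + 1 + b inputs; the a inputs of x on the left come first in the
   result, then the n inputs of y, then the b inputs of x on the right. *)
Record operad_data := OperadData {
  op_car :> nat -> lmodType rat;
  op_act : forall n, 'S_n -> op_car n -> op_car n;
  op_unit : op_car 1;
  op_comp : forall a b n, op_car (a.+1 + b) -> op_car n -> op_car (a + (n + b))
}.
Arguments op_act P {n} s x : rename.
Arguments op_unit P : rename.
Arguments op_comp P {a b n} x y : rename.

Section Monoid.
Variable P : operad_data.

Definition coinv (n : nat) : lmodType rat :=
  lquot (fun z : P n => exists (s : 'S_n) (x : P n), z = op_act P s x - x).

Definition to_coinv (n : nat) (x : P n) : coinv n := cls _ x.
Definition of_coinv (n : nat) (q : coinv n) : P n := repr q.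

(* [gamma a b x d y] fills the first a inputs of x with y 0, .., y (a - 1), from
   the last one to the first one, leaving the b other inputs untouched; for
   b = 0 it is gamma (x, y 0, .., y (a - 1)).  The values of d and y beyond a
   are irrelevant. *)
Fixpoint gamma_arity (a b : nat) (d : nat -> nat) : nat :=
  if a is a'.+1 then gamma_arity a' (d a' + b) d else b.

Fixpoint gamma (a b : nat) (x : P (a + b)) (d : nat -> nat)
    (y : forall i, P (d i)) {struct a} : P (gamma_arity a b d) :=
  match a return P (a + b) -> P (gamma_arity a b d) with
  | 0 => fun x => x
  | a'.+1 => fun x => gamma (op_comp P x (y a')) y
  end x.

Definition op_cast (m n : nat) (e : m = n) (x : P m) : P n :=
  ecast i (P i) e x.

(* The product of the coinvariants over the arities >= 1: the component of
   index n is the one of arity n + 1. *)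
Definition hat : Type := forall n : nat, coinv n.+1.

Definition hat_of (k : nat) (x : P k) : hat := fun n =>
  match @eqP _ k n.+1 with
  | ReflectT e => to_coinv (op_cast e x)
  | ReflectF _ => 0
  end.

Definition hat_one : hat := hat_of (op_unit P).

Definition hat_gamma (x y : hat) (m : nat) (k : nat -> nat) : hat :=
  hat_of (gamma (op_cast (esym (addn0 m.+1)) (of_coinv (x m)))
                (fun i => of_coinv (y (k i)))).

(* The sum over all m >= 1 and n_1, .., n_m >= 1 (each of them shifted by one
   here).  In arity n + 1 only the terms with n_1 + .. + n_m = n + 1
   contribute, so that m and the n_i may be bounded by n + 1. *)
Definition hat_mul (x y : hat) : hat := fun n =>
  \sum_(m < n.+1) \sum_(k : m.+1.-tuple 'I_n.+1)
     hat_gamma x y m (fun i => nth ord0 k i) n.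

Definition hat_inverse (x y : hat) : Prop :=
  hat_mul x y = hat_one /\ hat_mul y x = hat_one.

Definition in_G (x : hat) : Prop := exists y, hat_inverse x y.

End Monoid.

Definition hat_map (P Q : operad_data) (phi : forall n, P n -> Q n)
    (x : hat P) : hat Q :=
  fun n => to_coinv (phi n.+1 (of_coinv (x n))).

(* Meaningful when the spans of the sets A n form an operadic ideal: the
   structure maps are computed on arbitrary representatives. *)
Section QuotientOperad.
Variables (P : operad_data) (A : forall n, P n -> Prop).

Definition quot_operad : operad_data :=
  @OperadData (fun n => lquot (@A n))
    (fun n s x => cls _ (op_act P s (repr x)))
    (cls _ (op_unit P))
    (fun a b n x y => cls _ (op_comp P (repr x) (repr y))).

Definition quot_operad_proj (n : nat) (x : P n) : quot_operad n :=
  cls (@A n) x.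

End QuotientOperad.

(* A rooted tree on the vertices 'I_n is given by its parent function; the edges
   are directed towards the root, which is the vertex without parent. *)
Definition parent_fun (n : nat) := {ffun 'I_n -> option 'I_n}.

Definition is_tree (n : nat) (p : parent_fun n) : bool :=
  [exists r, (p r == None) && [forall v, connect [rel u w | p u == Some w] v r]].

Definition tree (n : nat) : Type := {p : parent_fun n | is_tree p}.

Definition par (n : nat) (T : tree n) : parent_fun n := val T.

Lemma is_treeP n (p : parent_fun n) :
  reflect (exists2 r, p r = None &
             forall v, connect [rel u w | p u == Some w] v r) (is_tree p).
Proof.
apply: (iffP existsP) => [[r /andP [/eqP pr /forallP h]]|[r pr h]]; exists r => //.
by rewrite pr eqxx; apply/forallP.
Qed.

Lemma tree_no_loop n (T : tree n) v : par T v != Some v.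
Proof.
case: T => p /=; rewrite /par /= => /is_treeP [r pr h]; apply/eqP => pv.
have [s sp rs] := connectP (h v).
suff: r = v by move=> rv; move: pr; rewrite rv pv.
rewrite rs; elim: s {rs} v pv sp => //= w s IH v pv /andP [/eqP pvw].
by move: pvw; rewrite pv => -[<-]; apply: IH.
Qed.


Lemma connect_homo (V W : finType) (e : rel V) (e' : rel W) (h : V -> W) :
  (forall x y, e x y -> connect e' (h x) (h y)) ->
  forall x y, connect e x y -> connect e' (h x) (h y).
Proof.
move=> eh x y /connectP [s sp ->]; elim: s x sp => //= z s IH x /andP [xz zs].
exact: connect_trans (eh _ _ xz) (IH _ zs).
Qed.

(* The vertex v of T becomes the vertex s v; since (s * t) v = t (s v), this is a
   right action of the symmetric group. *)
Section Relabel.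
Variables (n : nat) (s : 'S_n) (T : tree n).

Definition relabel_par : parent_fun n :=
  [ffun v => omap s (par T ((s^-1)%g v))].

Lemma relabel_is_tree : is_tree relabel_par.
Proof.
have [r pr h] := is_treeP _ (valP T).
apply/is_treeP; exists (s r); first by rewrite ffunE permK /par pr.
move=> v; rewrite -(permKV s v); apply: (connect_homo (h := s)) (h _).
move=> x y /= /eqP xy; apply: connect1.
by rewrite /= ffunE permK /par xy.
Qed.

Definition relabel : tree n := exist _ relabel_par relabel_is_tree.

End Relabel.

(* The vertices of the insertion of S at the vertex a of T are numbered as
   follows: the vertices 0, .., a - 1 of T, then the vertices of S, then the
   vertices a + 1, .., a + b of T. *)
Section Insertion.
Variables (a b n : nat) (T : tree (a.+1 + b)) (S : tree n).

Definition slot : 'I_(a.+1 + b) := lshift b ord_max.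

Definition ins_S (s : 'I_n) : 'I_(a + (n + b)) := rshift a (lshift b s).

(* [None] for the vertex [slot] only. *)
Definition ins_T (j : 'I_(a.+1 + b)) : option 'I_(a + (n + b)) :=
  match split j with
  | inl k => omap (lshift (n + b)) (unlift ord_max k)
  | inr k => Some (rshift a (rshift n k))
  end.

Definition ins_vertex (w : 'I_(a + (n + b))) : 'I_(a.+1 + b) + 'I_n :=
  match split w with
  | inl k => inl (lshift b (lift ord_max k))
  | inr k => match split k with
             | inl s => inr s
             | inr l => inl (rshift a.+1 l)
             end
  end.

(* An edge of T going into the vertex [slot] is given by its source. *)
Definition in_edge : Type := {j | par T j == Some slot}.

Definition insert_par (f : {ffun in_edge -> 'I_n}) : parent_fun (a + (n + b)) :=
  [ffun w =>
    match ins_vertex w with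
    | inl j => if insub j is Some e then Some (ins_S (f e))
               else obind ins_T (par T j)
    | inr s => if par S s is Some s' then Some (ins_S s')
               else obind ins_T (par T slot)
    end].

Lemma ins_vertexS s : ins_vertex (ins_S s) = inr s.
Proof.
rewrite /ins_vertex /ins_S; case: splitP => [k /= e|k /= /addnI e].
  by have := ltn_ord k; rewrite -e ltnNge leq_addr.
case: splitP => [l /= e'|l /= e']; first by congr inr; apply: val_inj; rewrite /= -e' -e.
by have := ltn_ord s; rewrite e e' ltnNge leq_addr.
Qed.

Lemma ins_T_slot : ins_T slot = None.
Proof.
rewrite /ins_T /slot; case: splitP => [k /= e|k /= e].
  by have -> : k = ord_max by [apply: val_inj]; rewrite unlift_none.
by have := ltnSn a; rewrite {1}e ltnNge leq_addr.
Qed.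

Lemma ins_T_some j : j != slot -> exists w, ins_T j = Some w.
Proof.
rewrite /ins_T; case: splitP => [k ek|k _ _]; last by eexists.
case: unliftP => [l _ _|kE /eqP []]; first by eexists.
by apply: val_inj; rewrite /= ek kE.
Qed.

Lemma ins_vertexT j w : ins_T j = Some w -> ins_vertex w = inl j.
Proof.
rewrite /ins_T; case: splitP => [k ek|k ek].
  case: unliftP => //= l kl [<-]; rewrite /ins_vertex.
  case: splitP => [l' /= e|l' /= e].
    congr inl; apply: val_inj; rewrite /= ek kl /=.
    by rewrite -e.
  by have := ltn_ord l; rewrite e ltnNge leq_addr.
move=> [<-]; rewrite /ins_vertex; case: splitP => [l /= e|l /= /addnI e].
  by have := ltn_ord l; rewrite -e ltnNge leq_addr.
case: splitP => [l' /= e'|l' /= e'].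
  by have := ltn_ord l'; rewrite -e' -e ltnNge leq_addr.
congr inl; apply: val_inj; rewrite /= ek; congr addn.
by apply/eqP; rewrite -(eqn_add2l n) e e'.
Qed.

Lemma ins_vertexP w :
  match ins_vertex w with
  | inl j => ins_T j = Some w
  | inr s => w = ins_S s
  end.
Proof.
rewrite /ins_vertex; case: splitP => [k ek|k ek].
  rewrite /ins_T; case: splitP => [l /= e|l /= e]; last first.
    by have := ltn_ord (lift ord_max k); rewrite /= e ltnNge leq_addr.
  have -> : l = lift ord_max k by apply: val_inj.
  by rewrite liftK /=; congr Some; apply: val_inj.
case: splitP => [s es|l el]; first by apply: val_inj; rewrite /= ek es.
rewrite /ins_T; case: splitP => [l' /= e|l' /= /addnI e].
  by have := ltn_ord l'; rewrite -e ltnNge leq_addr.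
by congr Some; apply: val_inj; rewrite /= ek el e.
Qed.

Lemma insert_is_tree f : is_tree (insert_par f).
Proof.
have [rS prS hS] := is_treeP _ (valP S); have [rT prT hT] := is_treeP _ (valP T).
set e' := [rel u w | insert_par f u == Some w].
have cS s : connect e' (ins_S s) (ins_S rS).
  apply: (connect_homo (h := ins_S)) (hS s) => x y /= /eqP xy.
  by apply: connect1; rewrite /= ffunE ins_vertexS /par xy.
pose h j := odflt (ins_S rS) (ins_T j).
have hslot : h slot = ins_S rS by rewrite /h ins_T_slot.
have cT j : connect e' (h j) (h rT).
  apply: (connect_homo (h := h)) (hT j) => x y /= /eqP xy.
  have [xs|xs] := eqVneq x slot.
    have ys : y != slot.
      by have := tree_no_loop T x; rewrite /par xy xs.
    have [w yw] := ins_T_some ys.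
    apply: connect1; rewrite /= xs hslot ffunE ins_vertexS /par prS.
    by rewrite -xs xy /= /h yw.
  have [w xw] := ins_T_some xs; rewrite {1}/h xw /=.
  have [ys|ys] := eqVneq y slot.
    have pxy : par T x == Some slot by rewrite /par xy ys.
    rewrite ys hslot; apply: connect_trans (connect1 _) (cS (f (exist _ x pxy))).
    by rewrite /= ffunE (ins_vertexT xw) (insubT (fun j => par T j == Some slot) pxy).
  have [w' yw] := ins_T_some ys.
  apply: connect1; rewrite /= ffunE (ins_vertexT xw).
  case: insubP => [u /eqP pu _|_]; last by rewrite /par xy /= /h yw.
  by case/eqP: ys; move: pu; rewrite /par xy => -[].
apply/is_treeP; exists (h rT); last first.
  move=> w; have := ins_vertexP w; case: ins_vertex => [j jw|s ->].
    by have := cT j; rewrite {1}/h jw.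
  by apply: connect_trans (cS s) _; rewrite -hslot.
have [rs|rs] := eqVneq rT slot.
  by rewrite rs hslot ffunE ins_vertexS /par prS -rs prT.
have [w rw] := ins_T_some rs.
rewrite /h rw /= ffunE (ins_vertexT rw).
by case: insubP => [u|_]; rewrite /par prT.
Qed.

Definition insert (f : {ffun in_edge -> 'I_n}) : tree (a + (n + b)) :=
  exist _ (insert_par f) (insert_is_tree f).

End Insertion.

(* A new edge goes from the root of T to the vertex s of S; the vertices of T are
   numbered before those of S. *)
Section Graft.
Variables (m n : nat) (S : tree n) (T : tree m) (s : 'I_n).

Definition graft_par : parent_fun (m + n) :=
  [ffun w =>
    match split w with
    | inl t => if par T t is Some t' then Some (lshift n t')
               else Some (rshift m s)
    | inr u => omap (@rshift m n) (par S u)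
    end].

Lemma graft_is_tree : is_tree graft_par.
Proof.
have [rS prS hS] := is_treeP _ (valP S); have [rT prT hT] := is_treeP _ (valP T).
set e' := [rel u w | graft_par u == Some w].
have splitl t : split (lshift n t) = inl t := unsplitK (inl t).
have splitr u : split (rshift m u) = inr u := unsplitK (inr u).
have cS u : connect e' (rshift m u) (rshift m rS).
  apply: (connect_homo (h := @rshift m n)) (hS u) => x y /= /eqP xy.
  by apply: connect1; rewrite /= ffunE splitr /par xy.
have cT t : connect e' (lshift n t) (lshift n rT).
  apply: (connect_homo (h := @lshift m n)) (hT t) => x y /= /eqP xy.
  by apply: connect1; rewrite /= ffunE splitl /par xy.
apply/is_treeP; exists (rshift m rS); first by rewrite ffunE splitr /par prS.
move=> w; case: (split_ordP w) => [t ->|u ->] //.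
apply: connect_trans (cT t) (connect_trans _ (cS s)).
by apply: connect1; rewrite /= ffunE splitl /par prT.
Qed.

Definition graft : tree (m + n) := exist _ graft_par graft_is_tree.

End Graft.

Definition corolla_par (n : nat) : parent_fun n.+1 :=
  [ffun v => if v == ord0 then None else Some ord0].

Lemma corolla_is_tree n : is_tree (corolla_par n).
Proof.
apply/is_treeP; exists ord0 => [|v]; first by rewrite ffunE eqxx.
have [->|v0] := eqVneq v ord0; first exact: connect0.
by apply: connect1; rewrite /= ffunE (negPf v0).
Qed.

Definition corolla (n : nat) : tree n.+1 := exist _ (corolla_par n) (corolla_is_tree n).

Definition one_vertex : tree 1 := corolla 0.

(* No chain r <- v <- u of three vertices starts at the root r. *)
Definition is_corolla (n : nat) (T : tree n) : bool :=
  [forall r, forall v, forall u,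
    ~~ [&& par T r == None, par T v == Some r & par T u == Some v]].

Definition prelie_space (n : nat) : lmodType rat := {ffun tree n -> rat^o}.

Definition tvec (n : nat) (T : tree n) : prelie_space n :=
  [ffun T' => (T' == T)%:R].

Definition prelie_act (n : nat) (s : 'S_n) (x : prelie_space n) : prelie_space n :=
  \sum_T x T *: tvec (relabel s T).

Definition prelie_comp (a b n : nat) (x : prelie_space (a.+1 + b))
    (y : prelie_space n) : prelie_space (a + (n + b)) :=
  \sum_T \sum_S (x T * y S) *: \sum_f tvec (@insert a b n T S f).

Definition PreLie : operad_data :=
  OperadData prelie_act (tvec one_vertex) prelie_comp.

Definition Mu : operad_data :=
  quot_operad (fun n (x : PreLie n) => exists2 T, ~~ is_corolla T & x = tvec T).

Definition psi : hat PreLie -> hat Mu :=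
  hat_map (@quot_operad_proj PreLie _ : forall n, PreLie n -> Mu n).

Definition prelie_graft (m n : nat) (x : PreLie n) (y : PreLie m) : PreLie (m + n) :=
  \sum_S \sum_T ((x : prelie_space n) S * (y : prelie_space m) T) *:
    \sum_s tvec (graft S T s).

(* The product x <- y, where the unlabeled trees with n vertices are seen as the
   classes of the labeled trees in the coinvariants. *)
Definition prelie_mul (m n : nat) (x : coinv PreLie n) (y : coinv PreLie m) :
    coinv PreLie (m + n) :=
  to_coinv (prelie_graft (of_coinv x) (of_coinv y)).

Definition gen_v : coinv PreLie 1 := @to_coinv PreLie 1 (tvec one_vertex).

(* The power of v with k + 1 factors. *)
Fixpoint vpow (k : nat) : coinv PreLie k.+1 :=
  if k is k'.+1 then prelie_mul (vpow k') gen_v else gen_v.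

Definition exp_star : hat PreLie := fun k => (k.+1`!%:R)^-1 *: vpow k.

(* A formal power series is given by the sequence of its coefficients. *)
Definition fps : Type := nat -> rat.

Definition fps_one : fps := fun n => (n == 0%N)%:R.
Definition fps_X : fps := fun n => (n == 1%N)%:R.
Definition fps_sub (f g : fps) : fps := fun n => f n - g n.
Definition fps_mul (f g : fps) : fps := fun n => \sum_(i < n.+1) f i * g (n - i)%N.
Definition fps_exp : fps := fun n => (n`!%:R)^-1.

(* f / x for a series f without constant term. *)
Definition fps_divX (f : fps) : fps := fun n => f n.+1.

(* 1 / f for a series f with f 0 <> 0; [fps_inv_seq f n] lists its coefficients
   of degree at most n. *)
Fixpoint fps_inv_seq (f : fps) (n : nat) : seq rat :=
  if n is n'.+1 then
    let s := fps_inv_seq f n' in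
    rcons s (- (f 0%N)^-1 * \sum_(i < n'.+1) s`_i * f (n'.+1 - i)%N)
  else [:: (f 0%N)^-1].

Definition fps_inv (f : fps) : fps := fun n => (fps_inv_seq f n)`_n.

Lemma size_fps_inv_seq f n : size (fps_inv_seq f n) = n.+1.
Proof. by elim: n => //= n IH; rewrite size_rcons IH. Qed.

Lemma fps_inv_seqE f m n : (m <= n)%N -> (fps_inv_seq f n)`_m = fps_inv f m.
Proof.
elim: n => [|n IH]; first by rewrite leqn0 => /eqP ->.
rewrite leq_eqVlt => /predU1P [-> //|mn].
by rewrite /= nth_rcons size_fps_inv_seq mn IH.
Qed.

Lemma fps_mulVf f : f 0%N != 0 -> fps_mul (fps_inv f) f =1 fps_one.
Proof.
move=> f0 [|n]; first by rewrite /fps_mul big_ord1 /fps_inv /= mulVf.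
rewrite /fps_mul big_ord_recr /= subnn {2}/fps_inv /= nth_rcons size_fps_inv_seq.
rewrite ltnn eqxx mulrAC mulNr mulVf // mulN1r.
under [X in _ - X]eq_bigr => i _ do rewrite fps_inv_seqE ?leq_ord //.
by rewrite subrr.
Qed.

(* (exp x - 1) / x and x / (exp x - 1) *)
Definition expm1_over_x : fps := fps_divX (fps_sub fps_exp fps_one).
Definition x_over_expm1 : fps := fps_inv expm1_over_x.

Lemma expm1_over_xP : fps_mul fps_X expm1_over_x =1 fps_sub fps_exp fps_one.
Proof.
case=> [|n]; rewrite /fps_mul; first by rewrite big_ord1 mul0r.
rewrite (bigD1 (Ordinal (isT : (1 < n.+2)%N))) //= mul1r big1 ?addr0; last first.
  by move=> i; rewrite -val_eqE /fps_X => /negPf /= ->; rewrite mul0r.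
by rewrite /expm1_over_x /fps_divX subSS subn0.
Qed.

Lemma x_over_expm1P : fps_mul x_over_expm1 (fps_sub fps_exp fps_one) =1 fps_X.
Proof.
have e0 : fps_sub fps_exp fps_one 0 = 0 by [].
case=> [|n]; rewrite /fps_mul; first by rewrite big_ord1 e0 mulr0.
rewrite big_ord_recr /= subnn e0 mulr0 addr0.
transitivity (fps_one n); last by [].
rewrite -(@fps_mulVf expm1_over_x isT n).
by apply: eq_bigr => i _; rewrite subSn ?leq_ord.
Qed.

Definition nu (m : nat) : coinv Mu m.+1 :=
  @to_coinv Mu m.+1 (@quot_operad_proj PreLie _ m.+1 (tvec (corolla m))).

(* The element of the group of Mu corresponding to the pair (l, f) of the
   semi-direct product: l is nonzero, f has constant term 1 and
   x = l * (sum over m >= 0 of f_m nu_m). *)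
Definition G_Mu_corresponds (x : hat Mu) (l : rat) (f : fps) : Prop :=
  [/\ in_G x, l != 0, f 0%N = 1 & x = (fun m => l *: (f m *: nu m))].

(* Main.v *)
Require Import Defs.
From HB Require Import structures.
From mathcomp Require Import all_boot all_order all_algebra perm.
From mathcomp Require Import boolp.
Set Implicit Arguments.
Unset Strict Implicit.
Unset Printing Implicit Defensive.
Import GRing.Theory.
Local Open Scope ring_scope.

(** Two independent ideas carry the proof: substitution is a morphism of pre-Lie
    algebras, which gives the invertibility of [exp_star], and the coefficients
    of corollas multiply like the series of the semi-direct product, which gives
    the two images.

    Invertibility.  For a fixed [y] the map [hat_mul ^~ y] is linear and
    compatible with the pre-Lie product of the completion ([hat_mul_hat_graft]):
    it is the substitution of [y] for the generator v.  Let E(x) be the sum of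
    the (k+1)-fold right powers of x divided by (k+1)! ([hat_exp]).  Then
    exp* = E(v), and E commutes with every substitution ([hat_mul_hat_exp]).
    For the arity grading E(x) is x plus terms that depend on components of x of
    smaller arity only, so E is a bijection ([hat_exp_inj], [hat_exp_surj]).
    Let y be the solution of E(y) = v.  Substituting y in exp* = E(v) gives
    E(y) = v, so y is a right inverse.  Substituting exp* in y gives an element
    whose image under E is the substitution of exp* in E(y) = v, that is
    exp* = E(v); since E is injective this element is v, and y is a left inverse.

    The morphism property is a statement about trees.  A term of
    gamma (T; S_0, S_1, ...) is a tree P on the disjoint union W of the vertex
    sets of the S_v.  Inside a fibre W_v the edges of P are those of S_v, and the
    root of S_v may be attached to any vertex of the fibre over the parent of v.
    This is the relation [blowup] between T and P; it makes sense for any finite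
    set W over the vertices of T, so that no numbering of the vertices is needed
    until the class of a tree in the coinvariants is taken ([tree_class]).
    Blow-ups compose ([sum_blowup_comp]), hence the iterated partial
    compositions that define gamma enumerate the blow-ups of T ([fill_withE]).
    Finally, to blow up all the graftings of T on S amounts to blowing up T and S
    separately and grafting the first result at any vertex of the second one
    ([sum_blowup_graft]): if the root of T is attached to s in S, the root of its
    blow-up may be attached to any vertex over s, and s is arbitrary.

    Corollas.  Inserting S at a vertex of T gives a corolla in two ways only:
    either T is a corolla, S is a corolla inserted at its root and all the leaves
    go to the root of S, or T is a corolla and S is a single vertex replacing a
    leaf ([blowup_corolla_at]).  Let [chi] be the sum of the coefficients of the
    corollas; then the m-th term of x contributes to the component n of x * y by
    chi(x_m) chi(y_0)^m chi(y_(n-m)) ([chi_hat_mul]), which is the product of the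
    semi-direct product.  On the coinvariants of Mu, chi is the coordinate on
    [nu] ([coinv_mu_span]), and psi preserves chi.  Each right power of v has
    chi = 1, because a new vertex grafted on a corolla yields a corolla exactly
    when it is attached to the root.  Hence exp* has the series (exp x - 1) / x,
    and any inverse of it has the inverse series. *)

(** * Linear maps, quotients and finite sums *)

Lemma linear_zero (V W : lmodType rat) (f : V -> W) : linear f -> f 0 = 0.
Proof. by move=> fl; have := fl (-1) 0 0; rewrite scaler0 addr0 scaleN1r addNr. Qed.

Lemma linear_scale (V W : lmodType rat) (f : V -> W) k x :
  linear f -> f (k *: x) = k *: f x.
Proof. by move=> fl; rewrite -[k *: x]addr0 fl linear_zero ?addr0. Qed.

Lemma linear_big (V W : lmodType rat) (f : V -> W) (I : finType) (F : I -> V) :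
  linear f -> f (\sum_i F i) = \sum_i f (F i).
Proof.
move=> fl; apply: (big_morph f) => [x y|]; last exact: linear_zero.
by rewrite -[x]scale1r fl !scale1r.
Qed.

Lemma linear_in_span (V W : lmodType rat) (A : V -> Prop) (f : V -> W) :
  linear f -> (forall x, A x -> f x = 0) -> forall x, in_span A x -> f x = 0.
Proof.
move=> flin fA _ [s + ->].
elim: s => [|c s IH] sA; first by rewrite big_nil linear_zero.
rewrite big_cons flin IH => [|c' cs]; last by apply: sA; rewrite inE cs orbT.
by rewrite fA ?scaler0 ?addr0 //; apply: sA; rewrite inE eqxx.
Qed.

Lemma in_span_linear (V W : lmodType rat) (A : V -> Prop) (B : W -> Prop)
    (f : V -> W) :
  linear f -> (forall x, A x -> in_span B (f x)) ->
  forall x, in_span A x -> in_span B (f x).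
Proof.
move=> flin fA _ [s + ->].
elim: s => [|c s IH] sA; first by rewrite big_nil linear_zero //; apply: in_span0.
rewrite big_cons flin; apply: in_spanD; last first.
  by apply: IH => c' cs; apply: sA; rewrite inE cs orbT.
by apply/in_spanZ/fA/sA; rewrite inE eqxx.
Qed.

Section Coinvariants.
Variable P : operad_data.

(** The coinvariants are used through chosen representatives; this is what makes
    an invariant linear map insensitive to the choice. *)
Lemma coinv_lift i (W : lmodType rat) (f : P i -> W) :
  linear f -> (forall (s : 'S_i) x, f (op_act P s x) = f x) ->
  forall x, f (of_coinv (to_coinv x)) = f x.
Proof.
move=> fl fs x; apply/eqP; rewrite -subr_eq0; apply/eqP.
rewrite (_ : _ - _ = f (of_coinv (to_coinv x) - x)); last first.
  by rewrite addrC -scaleN1r -fl scaleN1r addrC.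
apply: (linear_in_span fl _ (repr_cls _ x)) => _ [s [z ->]].
by rewrite addrC -scaleN1r fl fs scaleN1r addNr.
Qed.

Lemma coinv_lift_linear i (W : lmodType rat) (f : P i -> W) :
  linear f -> (forall (s : 'S_i) x, f (op_act P s x) = f x) ->
  linear (fun q : coinv P i => f (of_coinv q)).
Proof.
move=> fl fs c; elim/lquot_ind => u; elim/lquot_ind => v.
by rewrite -linearP /= !coinv_lift // fl.
Qed.

Lemma hat_of_linear k n : linear (fun x : P k => hat_of x n).
Proof.
move=> c x y; rewrite /hat_of; case: eqP => [e|_]; last by rewrite scaler0 addr0.
by case: _ / e; exact: cls_is_linear.
Qed.

Lemma hat_of_coinv m (x : P m) n : hat_of (of_coinv (to_coinv x)) n = hat_of x n.
Proof. by rewrite /hat_of; case: eqP => // e; case: _ / e; apply: cls_repr. Qed.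

Lemma hat_of_self n (u : coinv P n.+1) : hat_of (of_coinv u) n = u.
Proof.
rewrite /hat_of; case: eqP => // e; rewrite (eq_irrelevance e (erefl _)).
exact: cls_repr.
Qed.

Lemma hat_of_neq k n (x : P k.+1) : k <> n -> hat_of x n = 0.
Proof. by move=> kn; rewrite /hat_of; case: eqP => // e; case: kn; case: e. Qed.

End Coinvariants.

Lemma sum_mul_eq (T : finType) (F : T -> rat) (t : T) :
  \sum_x F x * (x == t)%:R = F t.
Proof.
rewrite (bigD1 t) //= eqxx mulr1 big1 ?addr0 // => x /negPf ->.
by rewrite mulr0.
Qed.

Lemma sum_ord_zero (R : nmodType) (f : nat -> R) m M : (m <= M)%N ->
  (forall k, (m <= k)%N -> f k = 0) -> \sum_(k < M) f k = \sum_(k < m) f k.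
Proof.
move=> mM f0; rewrite -!(big_mkord xpredT f) (big_cat_nat (n := m)) //=.
rewrite [X in _ + X]big1_seq ?addr0 // => c.
by rewrite mem_index_iota => /andP [_ /andP [mc _]]; apply: f0.
Qed.

Lemma exchange_big22 (R : nmodType) (I J K L : finType) (A : pred K) (B : pred L)
    (F : I -> J -> K -> L -> R) :
  \sum_i \sum_j \sum_(k | A k) \sum_(l | B l) F i j k l =
  \sum_(k | A k) \sum_(l | B l) \sum_i \sum_j F i j k l.
Proof.
under eq_bigr => i _ do rewrite exchange_big /=.
rewrite exchange_big /=; apply: eq_bigr => k _.
under eq_bigr => i _ do rewrite exchange_big /=.
by rewrite exchange_big.
Qed.

Lemma scaler_sum2 (V : lmodType rat) (I J : finType) c (F : I -> J -> V) :
  \sum_i \sum_j c *: F i j = c *: \sum_i \sum_j F i j.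
Proof. by rewrite scaler_sumr; apply: eq_bigr => i _; rewrite scaler_sumr. Qed.

Lemma sum_tuple (T : finType) (R : nmodType) m (F : {ffun 'I_m -> T} -> R) :
  \sum_(k : m.-tuple T) F [ffun i => tnth k i] = \sum_f F f.
Proof.
rewrite (reindex (fun f : {ffun 'I_m -> T} => [tuple f i | i < m])) /=.
  apply: eq_bigr => f _; congr F; apply/ffunP => i.
  by rewrite ffunE tnth_mktuple.
exists (fun k : m.-tuple T => [ffun i => tnth k i]) => [f _|k _].
  by apply/ffunP => i; rewrite ffunE tnth_mktuple.
by apply/eq_from_tnth => i; rewrite tnth_mktuple ffunE.
Qed.

Lemma sum_tuple_rcons (R : nmodType) (T : finType) (x0 : T) a (F : a.+1.-tuple T -> R) :
  \sum_k F k = \sum_c \sum_(k : a.-tuple T) F [tuple of rcons k c].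
Proof.
rewrite pair_big /= (reindex (fun u : T * a.-tuple T => [tuple of rcons u.2 u.1])) //.
exists (fun k : a.+1.-tuple T => (nth x0 k a, [tuple nth x0 k i | i < a])) => [[c k] _|k _] /=.
  rewrite nth_rcons size_tuple ltnn eqxx; congr pair; apply: eq_from_tnth => i.
  by rewrite tnth_mktuple /= nth_rcons size_tuple ltn_ord -tnth_nth.
apply: val_inj; apply: (@eq_from_nth _ x0); rewrite /= ?size_rcons ?size_tuple ?card_ord //.
move=> i; rewrite ltnS => ia; rewrite nth_rcons size_tuple card_ord.
move: ia; rewrite leq_eqVlt; case/predU1P => [->|ia]; first by rewrite ltnn eqxx.
rewrite ia; transitivity (tnth [tuple nth x0 k i | i < a] (Ordinal ia)).
  by rewrite (tnth_nth x0).
by rewrite tnth_mktuple.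
Qed.

Definition ffun_rcons (T : Type) a (G : {ffun 'I_a -> T}) (c : T) : {ffun 'I_a.+1 -> T} :=
  [ffun i => if unlift ord_max i is Some j then G j else c].

Lemma sum_ffun_rcons (R : nmodType) (T : finType) a (F : {ffun 'I_a.+1 -> T} -> R) :
  \sum_G F G = \sum_c \sum_(G : {ffun 'I_a -> T}) F (ffun_rcons G c).
Proof.
rewrite pair_big /= (reindex (fun u : T * {ffun 'I_a -> T} => ffun_rcons u.2 u.1)) //.
exists (fun G : {ffun 'I_a.+1 -> T} => (G ord_max,
  [ffun i => G (lift ord_max i)])) => [[c G] _|G _] /=.
  by rewrite ffunE unlift_none; congr pair; apply/ffunP => i; rewrite !ffunE liftK.
by apply/ffunP => i; rewrite ffunE; case: unliftP => [j ->|->]; rewrite ?ffunE.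
Qed.

Definition ffun_sum (A B : finType) (T : Type) (G : {ffun A -> T}) (G' : {ffun B -> T}) :
  {ffun A + B -> T} := [ffun v => match v with inl a => G a | inr b => G' b end].

Lemma sum_ffun_sum (R : nmodType) (A B T : finType) (F : {ffun A + B -> T} -> R) :
  \sum_G F G = \sum_(G' : {ffun B -> T}) \sum_(G : {ffun A -> T}) F (ffun_sum G G').
Proof.
rewrite pair_big /= (reindex (fun u : {ffun B -> T} * {ffun A -> T} => ffun_sum u.2 u.1)) //.
exists (fun G : {ffun A + B -> T} => ([ffun b => G (inr b)],
  [ffun a => G (inl a)])) => [[G' G] _|G _] /=.
  by congr pair; apply/ffunP => i; rewrite !ffunE.
by apply/ffunP => -[a|b]; rewrite !ffunE.
Qed.


(** * Blow-ups of parent functions, and insertions as blow-ups *)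

Section Blow.
Variables (V W : finType) (pi : W -> V) (q : W -> option W).

(** The relation between a parent function [p] on [V] and a parent function [P] on
    a set [W] over [V] whose fibres carry forests [q]: the edges of [q] are kept,
    and a root of a fibre is attached to any vertex over the parent of its image.
    Stating this as a condition on [P], and not through the choices of attaching
    vertices, turns bijections between families of choices into equivalences. *)
Definition blowup (p : V -> option V) (P : W -> option W) : bool :=
  [forall w, if q w is Some w' then P w == Some w'
             else omap pi (P w) == p (pi w)].

Lemma blowupP p P :
  reflect (forall w, if q w is Some w' then P w = Some w'
                     else omap pi (P w) = p (pi w)) (blowup p P).
Proof.
apply: (iffP forallP) => h w; have := h w; case: (q w) => [w'|].
- by move/eqP.
- by move/eqP.
- by move->.
- by move->.
Qed.

End Blow.

Section InsertBlow.
Variables (a b n : nat).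
Notation U := 'I_(a + (n + b)).
Notation V := 'I_(a.+1 + b).

Definition ins_proj (w : U) : V :=
  match ins_vertex w with inl j => j | inr _ => slot a b end.

Definition ins_par (S : tree n) (w : U) : option U :=
  match ins_vertex w with inl _ => None | inr s => omap (@ins_S a b n) (par S s) end.

Lemma ins_S_inj : injective (@ins_S a b n).
Proof. by move=> s t /rshift_inj /lshift_inj. Qed.

Lemma ins_vertex_slot (w : U) : ins_vertex w <> inl (slot a b).
Proof. by move=> e; have := ins_vertexP w; rewrite e ins_T_slot. Qed.

Lemma ins_proj_slot (w : U) : ins_proj w = slot a b -> exists s : 'I_n, w = ins_S a b s.
Proof.
rewrite /ins_proj; have := ins_vertexP w; have := @ins_vertex_slot w.
case: ins_vertex => [j h _ e|s _ -> _]; last by exists s.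
by rewrite e in h.
Qed.

Lemma ins_projS (s : 'I_n) : ins_proj (ins_S a b s) = slot a b.
Proof. by rewrite /ins_proj ins_vertexS. Qed.

Lemma ins_projT j (w : U) : ins_T n j = Some w -> ins_proj w = j.
Proof. by move/ins_vertexT; rewrite /ins_proj => ->. Qed.

Lemma ins_proj_ins_T (w : U) : ins_proj w != slot a b -> ins_T n (ins_proj w) = Some w.
Proof.
by rewrite /ins_proj; have := ins_vertexP w; case: ins_vertex => // s; rewrite eqxx.
Qed.

(** Outside the inserted tree the projection is injective, which is why the only
    freedom in an insertion is the choice of [f]. *)
Lemma omap_ins_proj (o : option U) (o' : option V) :
  o' <> Some (slot a b) ->
  omap ins_proj o = o' <-> o = obind (ins_T n) o'.
Proof.
case: o' => [j|] /=; last by case: o.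
move=> js; have {}js : j != slot a b by apply/eqP => e; case: js; rewrite e.
have [w jw] := ins_T_some n js; rewrite jw.
split=> [|->]; last by rewrite /= (ins_projT jw).
case: o => //= u [uj]; congr Some.
by have := @ins_proj_ins_T u; rewrite uj js jw => /(_ isT) [].
Qed.

Variables (T : tree (a.+1 + b)) (S : tree n).

Lemma insert_blowup (f : {ffun in_edge T -> 'I_n}) : blowup ins_proj (ins_par S) (par T)
  (insert_par S f).
Proof.
apply/blowupP => w; rewrite ffunE /ins_par.
have := ins_vertexP w; rewrite {2}/ins_proj.
case: ins_vertex => [j jw|s _] /=.
  case: insubP => [[e pe] /= pj ej|pj]; first by rewrite ins_projS (eqP pj).
  by apply/omap_ins_proj => // e; rewrite e eqxx in pj.
case: (par S s) => [s'|] //=.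
apply/omap_ins_proj => // e.
by have := tree_no_loop T (slot a b); rewrite e eqxx.
Qed.

Lemma blowup_insert (P : parent_fun (a + (n + b))) :
  blowup ins_proj (ins_par S) (par T) P ->
  exists f : {ffun in_edge T -> 'I_n}, P = insert_par S f.
Proof.
move=> /blowupP h.
have hf (e : in_edge T) : exists s, obind P (ins_T n (val e)) = Some (ins_S a b s).
  case: e => j /= pj.
  have js : j != slot a b.
    by apply/eqP => e; have := tree_no_loop T j; rewrite (eqP pj) e eqxx.
  have [w jw] := ins_T_some n js; rewrite jw /=.
  have := h w; rewrite /ins_par (ins_vertexT jw) (ins_projT jw) (eqP pj).
  by case: (P w) => //= u [/ins_proj_slot [s ->]]; exists s.
pose f := [ffun e => sval (cid (hf e))].
exists f; apply/ffunP => w; rewrite ffunE.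
have := h w; rewrite /ins_par; have := ins_vertexP w; rewrite {2}/ins_proj.
case: ins_vertex => [j jw|s _] /=.
  case: insubP => [e pe ej|pj]; last by move/omap_ins_proj; apply=> e; rewrite e eqxx in pj.
  by move=> _; rewrite ffunE; case: cid => s /=; rewrite ej jw.
case: (par S s) => [s'|] //= /omap_ins_proj; apply=> e.
by have := tree_no_loop T (slot a b); rewrite e eqxx.
Qed.

Lemma insert_par_inj : injective (@insert_par a b n T S).
Proof.
move=> f g fg; apply/ffunP => e.
have js : val e != slot a b.
  by apply/eqP => es; have := tree_no_loop T (val e); rewrite (eqP (valP e)) es eqxx.
have [w jw] := ins_T_some n js.
have /ffunP/(_ w) := fg; rewrite !ffunE (ins_vertexT jw) valK.
by move=> h; apply: ins_S_inj (Some_inj h).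
Qed.

(** The map [f] that defines an insertion can be read off from its result, so at most
    one term of the sum is nonzero. *)
Lemma sum_insert (T' : tree (a + (n + b))) :
  \sum_(f : {ffun in_edge T -> 'I_n}) (T' == insert S f)%:R
    = (blowup ins_proj (ins_par S) (par T) (par T'))%:R :> rat.
Proof.
case: (boolP (blowup _ _ _ _)) => [/blowup_insert [f ef]|nb].
  rewrite (bigD1 f) //= big1 ?addr0 => [|g gf].
    by rewrite (_ : T' == _) //; apply/eqP/val_inj.
  case: eqP => // eg; case/eqP: gf.
  by apply: insert_par_inj; rewrite -ef eg.
rewrite big1 // => f _; case: eqP => // ef; case/negP: nb.
by rewrite ef; apply: insert_blowup.
Qed.

End InsertBlow.

Lemma prelie_compE a b n (x : prelie_space (a.+1 + b)) (y : prelie_space n) T' :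
  prelie_comp x y T' =
  \sum_T \sum_S (x T * y S) * (blowup (@ins_proj a b n) (ins_par S) (par T) (par T'))%:R.
Proof.
rewrite /prelie_comp sum_ffunE; apply: eq_bigr => T _.
rewrite sum_ffunE; apply: eq_bigr => S _.
rewrite !ffunE sum_ffunE -sum_insert; congr (_ * _).
by apply: eq_bigr => f _; rewrite ffunE.
Qed.


(** * Corolla coefficients of a product *)

Section RootCoefficients.
Variables (P : operad_data) (c : forall n, 'I_n -> P n -> rat).

Definition corolla_sum n (x : P n) : rat := \sum_r c r x.

(** The coefficient of the unit, hence 0 outside arity one. *)
Definition corolla_sum1 n (x : P n) : rat := (n == 1)%:R * corolla_sum x.

(** The coefficients of the corollas satisfy this in PreLie and in Mu: the root of a
    corolla obtained by insertion comes from one of the two trees, and the other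
    vertices must be attached to it. *)
Hypothesis c_comp : forall a b n (x : P (a.+1 + b)) (y : P n) r,
  c r (op_comp P x y) =
  match ins_vertex r with
  | inl j => c j x * corolla_sum1 y
  | inr s => c (slot a b) x * c s y
  end.

Lemma sum_slot (F : nat -> rat) a b (G : 'I_(a.+1 + b) -> rat) :
  \sum_(j < a.+1 + b) G j * F j =
  \sum_(k < a) G (lshift b (lift ord_max k)) * F k + G (slot a b) * F a
    + \sum_(l < b) G (rshift a.+1 l) * F (a.+1 + l)%N.
Proof.
rewrite big_split_ord big_ord_recr /=; congr (_ + _ + _).
by apply: eq_bigr => k _; congr (G _ * F _); apply: val_inj; rewrite /= /bump leqNgt ltn_ord.
Qed.

(** A corolla occurs in the composite only if the [y i] are filled in by single
    vertices except at the root [j] of a corolla of [x].  The empty inputs beyond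
    [a], needed for the induction, behave as if they were filled with the unit. *)
Lemma corolla_sum_gamma a b (x : P (a + b)) d (y : forall i, P (d i)) :
  corolla_sum (gamma x y) =
  \sum_(j < a + b) c j x *
     \prod_(i < a) (if i == j :> nat then corolla_sum (y i) else corolla_sum1 (y i)).
Proof.
elim: a b x => [|a IH] b x /=.
  by apply: eq_bigr => j _; rewrite big_ord0 mulr1.
rewrite IH.
pose F (j : nat) := \prod_(i < a.+1) (if i == j :> nat then corolla_sum (y i)
  else corolla_sum1 (y i)).
pose F' (j : nat) := \prod_(i < a) (if i == j :> nat then corolla_sum (y i)
  else corolla_sum1 (y i)).
rewrite -[RHS]/(\sum_j c j x * F j) -[LHS]/(\sum_j c j _ * F' j).
have FE (j : nat) : F j = F' j * (if a == j then corolla_sum (y a) else corolla_sum1 (y a)).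
  by rewrite /F big_ord_recr.
(* the product does not depend on a root beyond the filled inputs *)
have F'ge (j : nat) : (a <= j)%N -> F' j = F' a.
  move=> aj; apply: eq_bigr => i _.
  by rewrite !ltn_eqF // (leq_trans (ltn_ord i)).
rewrite (sum_slot F) big_split_ord big_split_ord /= addrA.
congr (_ + _ + _).
- apply: eq_bigr => k _; rewrite c_comp FE.
  have -> : ins_vertex (lshift (d a + b) k) = inl (lshift b (lift ord_max k)).
    by rewrite /ins_vertex (unsplitK (inl k)).
  by rewrite gtn_eqF // mulrAC mulrA.
- rewrite FE eqxx; under eq_bigr => s _.
    rewrite c_comp (ins_vertexS a b s) F'ge ?leq_addr //.
    rewrite -mulrA [c s _ * _]mulrC; over.
  by rewrite -mulr_sumr -mulr_sumr.
- apply: eq_bigr => l _; rewrite c_comp FE.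
  have -> : ins_vertex (rshift a (rshift (d a) l)) = inl (rshift a.+1 l).
    by rewrite /ins_vertex (unsplitK (inr _)) (unsplitK (inr l)).
  rewrite ltn_eqF ?ltn_addr // F'ge ?leq_addr // [in RHS]F'ge; last first.
    by rewrite addSnnS leq_addr.
  by rewrite mulrAC mulrA.
Qed.

Hypothesis c_linear : forall n (r : 'I_n), linear (c r : P n -> rat^o).
Hypothesis corolla_sum_act : forall n (s : 'S_n) (x : P n), corolla_sum (op_act P s x) =
  corolla_sum x.

Lemma corolla_sum_linear n : linear (@corolla_sum n : P n -> rat^o).
Proof.
move=> k x y; rewrite /corolla_sum scaler_sumr -big_split /=; apply: eq_bigr => r _.
exact: (c_linear r).
Qed.

Definition chi n (p : coinv P n) : rat := corolla_sum (of_coinv p).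

Lemma chi_coinv n (x : P n) : chi (to_coinv x) = corolla_sum x.
Proof. exact: (coinv_lift (@corolla_sum_linear n) (@corolla_sum_act n)). Qed.

Lemma chi_linear n : linear (@chi n : coinv P n -> rat^o).
Proof. exact: (coinv_lift_linear (@corolla_sum_linear n) (@corolla_sum_act n)). Qed.

Lemma chi_sum n (I : finType) (F : I -> coinv P n) :
  chi (\sum_i F i) = \sum_i chi (F i).
Proof. exact: (linear_big F (@chi_linear n)). Qed.

Lemma chi_hat_of k (z : P k) n : chi (hat_of z n) = (k == n.+1)%:R * corolla_sum z.
Proof.
rewrite /hat_of; case: eqP => [e|_]; last by rewrite (linear_zero (@chi_linear _)) mul0r.
by rewrite chi_coinv mul1r; case: _ / e.
Qed.

Lemma gamma_arity_sum a b d : gamma_arity a b d = (\sum_(i < a) d i + b)%N.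
Proof.
by elim: a b => [|a IH] b /=; rewrite ?big_ord0 // IH big_ord_recr /= addnA.
Qed.

Lemma sum_op_cast k l (e : k = l) (z : P k) (F : nat -> rat) :
  \sum_(j < l) c j (op_cast e z) * F j = \sum_(j < k) c j z * F j.
Proof. by case: _ / e. Qed.

(** The arity condition of [hat_of] is moved to the factor of the root: if all the
    other entries have arity one, it determines the arity of that entry.  The sum
    over [k] then factors. *)
Lemma chi_hat_gamma (x y : hat P) n m (k : m.+1.-tuple 'I_n.+1) :
  chi (hat_gamma x y m (fun i => nth ord0 k i) n) =
  \sum_(j < m.+1) c j (of_coinv (x m)) * \prod_(i < m.+1)
     (if i == j then (tnth k i + m == n)%N%:R * chi (y (tnth k i))
      else (tnth k i == ord0)%:R * chi (y 0%N)).
Proof.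
have nthk (i : 'I_m.+1) : nth ord0 k i = tnth k i by rewrite (tnth_nth ord0).
rewrite /hat_gamma chi_hat_of corolla_sum_gamma gamma_arity_sum addn0.
rewrite (sum_op_cast _ _ (fun j : nat => \prod_(i < m.+1)
  (if i == j :> nat then corolla_sum _ else corolla_sum1 _))) mulr_sumr.
apply: eq_bigr => j _; rewrite mulrCA; congr (_ * _).
rewrite [X in _ * X = _](bigD1 j) //= eqxx nthk [RHS](bigD1 j) //= eqxx.
set Z := (X in _ * (_ * X) = _); set Z' := (X in _ = _ * X).
have ZZ' : Z = Z'.
  apply: eq_bigr => i ij; rewrite (negPf ij) ifN; last by rewrite (inj_eq val_inj).
  rewrite nthk /corolla_sum1 -/(chi _) eqSS -val_eqE /=.
  by have [e|_] := eqVneq (tnth k i : nat) 0%N; rewrite ?mul0r // e.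
have [/forall_inP k0|/forall_inPn [i ij ki]] :=
  boolP [forall (i | i != j), tnth k i == ord0].
  rewrite -ZZ' mulrA; congr (_%:R * _ * _).
  rewrite (bigD1 j) //= nthk (eq_bigr (fun=> 1%N)) => [|i ij]; last first.
    by rewrite nthk (eqP (k0 i ij)).
  by rewrite sum1_card cardC1 card_ord /= addSn eqSS.
have Z0 : Z' = 0 by rewrite /Z' (bigD1 i) //= (negPf ij) (negPf ki) !mul0r.
by rewrite ZZ' Z0 !mulr0.
Qed.

(** For each choice of the root [j] the sum over the tuples is a product of sums,
    where the root contributes [chi (y (n - m))] and each of the [m] other
    vertices contributes [chi (y 0)]. *)
Lemma chi_hat_mul (x y : hat P) n :
  chi (hat_mul x y n) =
  \sum_(m < n.+1) chi (x m) * chi (y 0%N) ^+ m * chi (y (n - m)%N).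
Proof.
rewrite /hat_mul chi_sum; apply: eq_bigr => -[m mn] _ /=.
rewrite chi_sum; under eq_bigr => k _ do rewrite chi_hat_gamma.
rewrite exchange_big /= {3}/chi /corolla_sum -mulrA mulr_suml; apply: eq_bigr => j _.
rewrite -mulr_sumr; congr (_ * _).
pose F i (e : 'I_n.+1) : rat := if i == j then (e + m == n)%N%:R * chi (y e)
  else (e == ord0)%:R * chi (y 0%N).
transitivity (\sum_(f : {ffun 'I_m.+1 -> 'I_n.+1}) \prod_(i < m.+1) F i (f i)).
  rewrite -(sum_tuple (fun f : {ffun _ -> _} => \prod_(i < m.+1) F i (f i))).
  by apply: eq_bigr => k _; apply: eq_bigr => i _; rewrite ffunE.
(* the sum over the tuples is a product of sums over their entries *)
rewrite -bigA_distr_bigA (bigD1 j) //= mulrC; congr (_ * _).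
  rewrite (eq_bigr (fun=> chi (y 0%N))) => [|i ij]; last first.
    rewrite /F (negPf ij) (bigD1 ord0) //= mul1r big1 ?addr0 // => e.
    by move/negPf ->; rewrite mul0r.
  by rewrite prodr_const cardC1 card_ord.
have nm : (n - m < n.+1)%N by rewrite ltnS leq_subr.
rewrite (bigD1 (Ordinal nm)) //= /F eqxx /= subnK // eqxx mul1r big1 ?addr0 //.
move=> e; rewrite -val_eqE /= => en; case: eqP => [em|_]; last by rewrite mul0r.
by case/eqP: en; rewrite -[in RHS]em addnK.
Qed.

End RootCoefficients.


(** * Corollas in PreLie *)

Section Corollas.
Variable n : nat.
Implicit Types (r v : 'I_n) (T : tree n).

Definition corolla_at_par r : parent_fun n :=
  [ffun v => if v == r then None else Some r].

Lemma corolla_at_is_tree r : is_tree (corolla_at_par r).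
Proof.
apply/is_treeP; exists r => [|v]; first by rewrite ffunE eqxx.
have [->|vr] := eqVneq v r; first exact: connect0.
by apply: connect1; rewrite /= ffunE (negPf vr).
Qed.

Definition corolla_at r : tree n := exist _ (corolla_at_par r) (corolla_at_is_tree r).

Lemma par_inj : injective (@par n).
Proof. exact: val_inj. Qed.

Lemma par_corolla_at r v : par (corolla_at r) v = if v == r then None else Some r.
Proof. by rewrite ffunE. Qed.

Lemma eq_corolla_atP T r :
  reflect (forall v, par T v = if v == r then None else Some r) (T == corolla_at r).
Proof.
apply: (iffP eqP) => [->|h]; first exact: par_corolla_at.
by apply/par_inj/ffunP => v; rewrite par_corolla_at h.
Qed.

Lemma corolla_at_inj : injective corolla_at.
Proof.
move=> r s /(congr1 (fun T => par T r)); rewrite !par_corolla_at eqxx.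
by case: eqP.
Qed.

Lemma is_corollaP T : reflect (exists r, T = corolla_at r) (is_corolla T).
Proof.
apply: (iffP idP) => [h|[r ->]]; last first.
  apply/forallP => r'; apply/forallP => v; apply/forallP => u.
  rewrite !par_corolla_at; apply/and3P => -[_]; have [_ /eqP //|vr _] := eqVneq v r.
  by case: (u == r) => // /eqP [] e; rewrite e eqxx in vr.
have [r pr cr] := is_treeP _ (valP T); exists r.
apply/eqP/eq_corolla_atP => v; have [->|] := eqVneq v r; first exact: pr.
have /connectP [s] := cr v.
elim: s v => [|w s IH] v /= => [_ -> /eqP //|/andP [/eqP vw] ws er vr].
have [wr|wr] := eqVneq w r; first by rewrite -wr.
have /forallP/(_ r)/forallP/(_ w)/forallP/(_ v) := h.
by rewrite (IH w) // /par pr vw !eqxx.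
Qed.

(** Used for a tree inserted at a leaf of a corolla: it cannot keep any edge. *)
Lemma no_edge_tree T : (forall v, par T v = None) -> n = 1%N.
Proof.
move=> h; have [r _ cr] := is_treeP _ (valP T).
have eqr v : v = r.
  have /connectP [[|w s] //= /andP [/eqP]] := cr v.
  by have := h v; rewrite /par => ->.
apply/eqP; rewrite -(card_ord n) (cardD1 r) -[X in _ == X](addn0 1) inE eqn_add2l.
by apply/eqP/eq_card0 => v; rewrite !inE (eqr v) eqxx.
Qed.

End Corollas.

Lemma tree1_corolla_at n (T : tree n) r : n = 1%N -> T = corolla_at r.
Proof.
move=> n1; subst n.
apply/eqP/eq_corolla_atP => v; rewrite (ord1 v) (ord1 r) eqxx.
have := tree_no_loop T ord0; case: (par T ord0) => // w.
by rewrite (ord1 w) eqxx.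
Qed.

Section InsertCorolla.
Variables (a b n : nat) (T : tree (a.+1 + b)) (S : tree n).

(** If the root of the corolla comes from [T], then [S] sits at a leaf and keeps no
    edge, so it has one vertex.  If it comes from [S], then [slot] has no parent,
    and all the other vertices of [T] must be attached to the root of [S]. *)
Lemma blowup_corolla_at (r : 'I_(a + (n + b))) :
  blowup (@ins_proj a b n) (ins_par S) (par T) (par (corolla_at r)) =
  match ins_vertex r with
  | inl j => (T == corolla_at j) && (n == 1%N)
  | inr s => (T == corolla_at (slot a b)) && (S == corolla_at s)
  end.
Proof.
have Tw j (w : 'I_(a + (n + b))) : ins_T n j = Some w ->
    ins_vertex w = inl j by move/ins_vertexT.
apply/blowupP/idP => h; last first.
  move=> w; rewrite par_corolla_at /ins_par.
  have := ins_vertexP r; have := @ins_vertex_slot _ _ _ r; move: h.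
  case er: (ins_vertex r) => [j|s] /andP [/eqP -> hS] jslot rE.
    have {}jslot : slot a b != j by apply/eqP => e; case: jslot; rewrite e.
    rewrite /ins_proj; have [->|wr] := eqVneq w r; first by rewrite er par_corolla_at eqxx.
    case ew: (ins_vertex w) => [k|s] /=.
      rewrite par_corolla_at er ifN //; apply: contra wr => /eqP kj.
      by have := ins_vertexP w; rewrite ew kj rE => -[->].
    have -> : par S s = None.
      by rewrite (tree1_corolla_at S s (eqP hS)) par_corolla_at eqxx.
    by rewrite par_corolla_at (negPf jslot) /= er.
  have slotj (w' : 'I_(a + (n + b))) j' : ins_vertex w' = inl j' -> j' != slot a b.
    by move=> e; apply/eqP => e'; case: (@ins_vertex_slot a b n w'); rewrite e e'.
  rewrite (eqP hS) /ins_proj rE.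
  case ew: (ins_vertex w) => [k|t] /=.
    rewrite par_corolla_at (negPf (slotj _ _ ew)) ifN /= ?ins_vertexS //.
    by apply/eqP => e; rewrite e ins_vertexS in ew.
  rewrite !par_corolla_at; have := ins_vertexP w; rewrite ew => ->.
  rewrite (inj_eq (@ins_S_inj a b n)) eqxx; by case: eqP.
have hS s s' : par S s = Some s' -> par (corolla_at r) (ins_S a b s) = Some (ins_S a b s').
  by move=> e; have := h (ins_S a b s); rewrite /ins_par ins_vertexS e.
have hr s : par S s = None -> omap (@ins_proj a b n) (par (corolla_at r)
  (ins_S a b s)) = par T (slot a b).
  by move=> e; have := h (ins_S a b s); rewrite /ins_par ins_vertexS e ins_projS.
have hT j w : ins_T n j = Some w -> omap (@ins_proj a b n) (par (corolla_at r) w) = par T j.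
  by move=> e; have := h w; rewrite /ins_par (Tw _ _ e) (ins_projT e).
have := ins_vertexP r; case er: (ins_vertex r) => [j|s] rE.
  have noS s : par S s = None.
    case e: (par S s) => [s'|] //; have := hS _ _ e; rewrite par_corolla_at.
    case: eqP => // _ [] e'; by rewrite e' ins_vertexS in er.
  rewrite (no_edge_tree noS) eqxx andbT; apply/eq_corolla_atP => k.
  have [ks|ks] := eqVneq k (slot a b).
    have n1 := no_edge_tree noS.
    have s0 : 'I_n by rewrite n1; exact: ord0.
    have := hr s0 (noS s0); rewrite par_corolla_at ks ifN; last first.
      by apply/eqP => e; rewrite -e ins_vertexS in er.
    rewrite /= /ins_proj er => <-; rewrite ifN //.
    by apply/eqP => e; case: (@ins_vertex_slot a b n r); rewrite er e.
  have [w kw] := ins_T_some n ks; have := hT k w kw; rewrite par_corolla_at => <-.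
  have [wr|wr] := eqVneq w r.
    have /ins_vertexT := kw; by rewrite wr er => -[->]; rewrite eqxx.
  rewrite ifN /= /ins_proj ?er //; apply: contra wr => /eqP kj.
  by rewrite kj rE in kw; case: kw => ->.
have Ss : S == corolla_at s.
  apply/eq_corolla_atP => t; case e: (par S t) => [t'|].
    have := hS _ _ e; rewrite par_corolla_at rE (inj_eq (@ins_S_inj a b n)).
    by case: eqP => // _ /Some_inj/ins_S_inj ->.
  have [//|ts] := eqVneq t s.
  have := hr _ e; rewrite par_corolla_at rE (inj_eq (@ins_S_inj a b n)) (negPf ts) /= ins_projS.
  by move=> e'; have := tree_no_loop T (slot a b); rewrite -e' eqxx.
rewrite Ss andbT; apply/eq_corolla_atP => k.
have [->|ks] := eqVneq k (slot a b).
  have := hr s; rewrite (eqP Ss) par_corolla_at eqxx => /(_ erefl) <-.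
  by rewrite par_corolla_at rE eqxx.
have [w kw] := ins_T_some n ks; have := hT k w kw; rewrite par_corolla_at => <-.
rewrite rE ifN /= ?ins_projS //.
by apply/eqP => e; have := ins_vertexT kw; rewrite e ins_vertexS.
Qed.

End InsertCorolla.

Definition prelie_coef n (r : 'I_n) (x : PreLie n) : rat :=
  (x : prelie_space n) (corolla_at r).

Lemma prelie_coef_comp a b n (x : PreLie (a.+1 + b)) (y : PreLie n) r :
  prelie_coef r (op_comp PreLie x y) =
  match ins_vertex r with
  | inl j => prelie_coef j x * corolla_sum1 prelie_coef y
  | inr s => prelie_coef (slot a b) x * prelie_coef s y
  end.
Proof.
rewrite /prelie_coef [LHS]prelie_compE.
under eq_bigr => T _ do under eq_bigr => S _ do rewrite blowup_corolla_at.
case: (ins_vertex r) => [j|s].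
  transitivity (\sum_T (x : prelie_space _) T * (T == corolla_at j)%:R *
                  ((n == 1%N)%:R * \sum_S (y : prelie_space n) S)).
    apply: eq_bigr => T _; rewrite !mulr_sumr; apply: eq_bigr => S _.
    by rewrite -mulnb natrM mulrACA; congr (_ * _); rewrite mulrC.
  rewrite -mulr_suml sum_mul_eq; congr (_ * _).
  rewrite /corolla_sum1; case: eqP y => [n1 y|_ y]; last by rewrite !mul0r.
  subst n; congr (_ * _).
  rewrite (bigD1 (corolla_at ord0)) //= big1 => [|S /eqP []]; last exact: tree1_corolla_at.
  by rewrite /corolla_sum big_ord1 addr0.
transitivity (\sum_T (x : prelie_space _) T * (T == corolla_at (slot a b))%:R *
                  (\sum_S (y : prelie_space n) S * (S == corolla_at s)%:R)).
  apply: eq_bigr => T _; rewrite !mulr_sumr; apply: eq_bigr => S _.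
  by rewrite -mulnb natrM mulrACA.
by rewrite -mulr_suml !sum_mul_eq.
Qed.

Lemma prelie_coef_linear n (r : 'I_n) : linear (prelie_coef r : PreLie n -> rat^o).
Proof. by move=> k x y; rewrite /prelie_coef !ffunE. Qed.

Lemma relabel_corolla_at n (s : 'S_n) (r : 'I_n) : relabel s (corolla_at r) = corolla_at (s r).
Proof.
apply/eqP/eq_corolla_atP => v; rewrite /par /= ffunE par_corolla_at.
by rewrite (can2_eq (permKV s) (permK s)); case: eqP.
Qed.

Lemma relabelK n (s : 'S_n) : cancel (@relabel n s) (@relabel n s^-1%g).
Proof.
move=> T; apply/par_inj/ffunP => v; rewrite /par /= !ffunE invgK permK.
by rewrite /par; case: (val T v) => //= w; rewrite permK.
Qed.

Lemma relabelKV n (s : 'S_n) : cancel (@relabel n s^-1%g) (@relabel n s).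
Proof. by move=> T; rewrite -{1}(invgK s) relabelK. Qed.

Lemma prelie_actE n (s : 'S_n) (x : prelie_space n) T :
  prelie_act s x T = x (relabel s^-1%g T).
Proof.
rewrite /prelie_act sum_ffunE -[RHS]sum_mul_eq; apply: eq_bigr => S _.
by rewrite !ffunE eq_sym (can2_eq (relabelK s) (relabelKV s)).
Qed.

Lemma prelie_corolla_sum_act n (s : 'S_n) (x : PreLie n) :
  corolla_sum prelie_coef (op_act PreLie s x) = corolla_sum prelie_coef x.
Proof.
rewrite /corolla_sum (reindex_inj (@perm_inj _ s)) /=; apply: eq_bigr => r _.
by rewrite /prelie_coef prelie_actE relabel_corolla_at permK.
Qed.


(** * Corollas in Mu *)

Definition mu_proj n (x : PreLie n) : Mu n :=
  @quot_operad_proj PreLie (fun n (x : PreLie n) => exists2 T, ~~ is_corolla T & x =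
    tvec T) n x.

Definition mu_coef n (r : 'I_n) (x : Mu n) : rat := prelie_coef r (repr x).

(** The trees divided out in Mu are not corollas, so their coefficients at corollas
    vanish. *)
Lemma mu_coefE n (r : 'I_n) x : mu_coef r (mu_proj x) = prelie_coef r x.
Proof.
apply/eqP; rewrite -subr_eq0; apply/eqP.
rewrite (_ : _ - _ = prelie_coef r (repr (mu_proj x) - x)); last first.
  by rewrite /prelie_coef !ffunE.
apply: (linear_in_span (prelie_coef_linear r) _ (repr_cls _ x)).
move=> _ [T nT ->]; rewrite /prelie_coef ffunE; case: eqP => // e.
by case/negP: nT; apply/is_corollaP; exists r.
Qed.

Lemma mu_coef_linear n (r : 'I_n) : linear (mu_coef r : Mu n -> rat^o).
Proof.
move=> k; elim/lquot_ind => x; elim/lquot_ind => y.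
rewrite -linearP /= !mu_coefE.
exact: prelie_coef_linear.
Qed.

Lemma mu_coef_comp a b n (x : Mu (a.+1 + b)) (y : Mu n) r :
  mu_coef r (op_comp Mu x y) =
  match ins_vertex r with
  | inl j => mu_coef j x * corolla_sum1 mu_coef y
  | inr s => mu_coef (slot a b) x * mu_coef s y
  end.
Proof. by rewrite [LHS]mu_coefE prelie_coef_comp. Qed.

Lemma mu_corolla_sum_act n (s : 'S_n) (x : Mu n) :
  corolla_sum mu_coef (op_act Mu s x) = corolla_sum mu_coef x.
Proof.
rewrite -[RHS]/(corolla_sum prelie_coef (repr x)) -(prelie_corolla_sum_act s).
by apply: eq_bigr => r _; apply: mu_coefE.
Qed.

Notation chi_prelie := (chi prelie_coef).
Notation chi_mu := (chi mu_coef).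

Lemma chi_prelie_coinv n (x : PreLie n) : chi_prelie (to_coinv x) = corolla_sum prelie_coef x.
Proof. by apply: chi_coinv; [exact: prelie_coef_linear|exact: prelie_corolla_sum_act]. Qed.

Lemma chi_mu_coinv n (x : Mu n) : chi_mu (to_coinv x) = corolla_sum mu_coef x.
Proof. by apply: chi_coinv; [exact: mu_coef_linear|exact: mu_corolla_sum_act]. Qed.

Lemma chi_mu_psi (x : hat PreLie) n : chi_mu (psi x n) = chi_prelie (x n).
Proof.
by rewrite chi_mu_coinv; apply: eq_bigr => r _; apply: mu_coefE.
Qed.

Lemma corolla_sum_tvec_corolla_at n (r : 'I_n) : corolla_sum prelie_coef (tvec (corolla_at
  r) : PreLie n) = 1.
Proof.
rewrite /corolla_sum (bigD1 r) //= /prelie_coef ffunE eqxx big1 ?addr0 // => s sr.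
by rewrite ffunE (inj_eq (@corolla_at_inj n)) (negPf sr).
Qed.

Lemma corollaE n : corolla n = corolla_at (@ord0 n).
Proof. exact: val_inj. Qed.

Lemma chi_mu_nu n : chi_mu (nu n) = 1.
Proof.
rewrite chi_mu_coinv -(corolla_sum_tvec_corolla_at (@ord0 n)) -corollaE.
by apply: eq_bigr => r _; apply: mu_coefE.
Qed.

Lemma prelie_act_linear n (s : 'S_n) : linear (prelie_act s).
Proof. by move=> k x y; apply/ffunP => T; rewrite !ffunE !prelie_actE !ffunE. Qed.

Lemma prelie_actB n (s : 'S_n) x y :
  prelie_act s (x - y) = prelie_act s x - prelie_act s y.
Proof. by apply/ffunP => T; rewrite !ffunE !prelie_actE !ffunE. Qed.

Lemma prelie_act_tvec n (s : 'S_n) T : prelie_act s (tvec T) = tvec (relabel s T).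
Proof.
apply/ffunP => T'; rewrite prelie_actE !ffunE.
by rewrite (can2_eq (relabelKV _) (relabelK _)).
Qed.

Lemma sum_corolla (V : nmodType) n (F : tree n -> V) :
  \sum_(T | is_corolla T) F T = \sum_r F (corolla_at r).
Proof.
transitivity (\sum_(T | is_corolla T) \sum_(r | T == corolla_at r) F T).
  apply: eq_bigr => T /is_corollaP [r ->].
  by rewrite (bigD1 r) //= big1 ?addr0 // => s /andP [/eqP/corolla_at_inj ->]; rewrite eqxx.
rewrite (exchange_big_dep predT) //=; apply: eq_bigr => r _.
rewrite (bigD1 (corolla_at r)) /=; last by rewrite eqxx andbT; apply/is_corollaP; exists r.
by rewrite big1 ?addr0 // => T /andP [/andP [_ /eqP ->]]; rewrite eqxx.
Qed.

Lemma mu_proj_act n (s : 'S_n) (x : PreLie n) :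
  op_act Mu s (mu_proj x) = mu_proj (op_act PreLie s x).
Proof.
apply/clsP; rewrite -prelie_actB.
apply: in_span_linear (repr_cls _ x) => [|_ [T nT ->]]; first exact: prelie_act_linear.
apply: in_span_gen; exists (relabel s T); last exact: prelie_act_tvec.
apply: contra nT => /is_corollaP [r e]; apply/is_corollaP.
by exists (s^-1%g r); rewrite -relabel_corolla_at -e relabelK.
Qed.

Lemma tvecE n (x : prelie_space n) : x = \sum_T x T *: tvec T.
Proof.
by apply/ffunP => T; rewrite sum_ffunE -[LHS](@sum_mul_eq _ x T);
   apply: eq_bigr => S _; rewrite !ffunE eq_sym.
Qed.

(** A corolla with a root other than 0 is the relabelling of [corolla m] by a
    transposition. *)
Lemma coinv_mu_span m (q : coinv Mu m.+1) : q = chi_mu q *: nu m.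
Proof.
elim/lquot_ind: q => X; elim/lquot_ind: X => x.
pose p : PreLie m.+1 -> coinv Mu m.+1 := fun x => to_coinv (mu_proj x).
rewrite -/(to_coinv _) -/(mu_proj x) -/(p x) chi_mu_coinv.
have -> : corolla_sum mu_coef (mu_proj x) = corolla_sum prelie_coef x.
  by apply: eq_bigr => r _; apply: mu_coefE.
have pl : linear p.
  move=> k y z; rewrite /p [mu_proj (_ + _)]cls_is_linear; exact: cls_is_linear.
have pZ k y : p (k *: y) = k *: p y by exact: linear_scale.
have pcor r : p (tvec (corolla_at r)) = nu m.
  rewrite -[r](tpermL ord0) -relabel_corolla_at; apply/clsP/in_span_gen.
  exists (tperm ord0 r), (mu_proj (tvec (corolla m))).
  by rewrite mu_proj_act [op_act _ _ _]prelie_act_tvec.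
have pnot T : ~~ is_corolla T -> p (tvec T) = 0.
  move=> nT; rewrite /p (_ : mu_proj _ = 0) ?linear0 //.
  transitivity (@mu_proj m.+1 0); last by rewrite /mu_proj /quot_operad_proj linear0.
  by apply/clsP; rewrite subr0; apply: in_span_gen; exists T.
rewrite [X in p X]tvecE linear_big //.
transitivity (\sum_(T | is_corolla T) (x : prelie_space _) T *: p (tvec T)).
  rewrite [RHS]big_mkcond; apply: eq_bigr => T _; rewrite pZ.
  by case: ifPn => // nT; rewrite pnot // scaler0.
rewrite sum_corolla /corolla_sum scaler_suml; apply: eq_bigr => r _.
by rewrite pcor.
Qed.


(** * The images of the exponential and of its inverse *)

(** The new vertex is numbered 0 and is not the root, whence the shift of [s]. *)
Lemma graft_eq_corolla_at n (S : tree n) (T : tree 1) (s : 'I_n) r :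
  (corolla_at r == graft S T s) = (r == rshift 1 s) && (S == corolla_at s).
Proof.
rewrite eq_sym; have p1 t : par T t = None.
  by rewrite (tree1_corolla_at T t erefl) par_corolla_at eqxx.
apply/eq_corolla_atP/andP => [h|[/eqP -> /eqP ->] v]; last first.
  rewrite /par /= ffunE; case: split_ordP => [t ->|u ->].
    by rewrite p1 eq_lrshift.
  by rewrite par_corolla_at eq_rshift; case: eqP.
have hl : r = rshift 1 s.
  have := h (lshift n ord0); rewrite /par /= ffunE (unsplitK (inl _)) p1.
  by case: eqP => // _ [].
rewrite hl; split=> //; apply/eq_corolla_atP => u.
have := h (rshift 1 u); rewrite /par /= ffunE (unsplitK (inr _)) hl eq_rshift.
by rewrite /par; case: (val S u) => [w|]; case: eqP => //= _ /Some_inj/rshift_inj ->.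
Qed.

Lemma corolla_sum_graft1 n (x : PreLie n) (y : PreLie 1) :
  corolla_sum prelie_coef (prelie_graft x y) = corolla_sum prelie_coef x * corolla_sum
    prelie_coef y.
Proof.
rewrite /corolla_sum big_ord1 mulr_suml /prelie_coef.
transitivity (\sum_(r < 1 + n) \sum_S \sum_T
  ((x : prelie_space n) S * (y : prelie_space 1) T) *
   \sum_s ((r == rshift 1 s) && (S == corolla_at s))%:R).
  apply: eq_bigr => r _; rewrite sum_ffunE; apply: eq_bigr => S _.
  rewrite sum_ffunE; apply: eq_bigr => T _; rewrite !ffunE sum_ffunE.
  by congr (_ * _); apply: eq_bigr => s _; rewrite ffunE graft_eq_corolla_at.
rewrite exchange_big /=.
transitivity (\sum_s \sum_S (x : prelie_space n) S * (y : prelie_space 1)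
  (corolla_at ord0) * (S == corolla_at s)%:R).
  rewrite [RHS]exchange_big; apply: eq_bigr => S _; rewrite exchange_big /=.
  rewrite (bigD1 (corolla_at ord0)) //= [X in _ + X]big1 ?addr0 => [|T /eqP []];
    last exact: tree1_corolla_at.
  rewrite -mulr_sumr exchange_big mulr_sumr /=; apply: eq_bigr => s _; congr (_ * _).
  rewrite (bigD1 (rshift 1 s)) //= eqxx /= big1 ?addr0 // => r /negPf -> //.
apply: eq_bigr => s _; under eq_bigr do rewrite mulrAC.
by rewrite -mulr_suml sum_mul_eq.
Qed.

Lemma chi_prelie_vpow k : chi_prelie (vpow k) = 1.
Proof.
elim: k => [|k IH] /=; first by rewrite chi_prelie_coinv [tvec _](_ : _ =
  tvec (corolla_at ord0)) ?corolla_sum_tvec_corolla_at // -corollaE.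
rewrite chi_prelie_coinv corolla_sum_graft1 -![corolla_sum _ _]/(chi_prelie _) IH mul1r.
by rewrite chi_prelie_coinv [tvec _](_ : _ = tvec (corolla_at ord0))
  ?corolla_sum_tvec_corolla_at // -corollaE.
Qed.

Lemma chi_prelieZ n k (x : coinv PreLie n) : chi_prelie (k *: x) = k * chi_prelie x.
Proof.
exact: (linear_scale k x (chi_linear prelie_coef_linear prelie_corolla_sum_act (n := n))).
Qed.

Lemma chi_muZ n k (x : coinv Mu n) : chi_mu (k *: x) = k * chi_mu x.
Proof.
exact: (linear_scale k x (chi_linear mu_coef_linear mu_corolla_sum_act (n := n))).
Qed.

Lemma chi_prelie_hat_mul (x y : hat PreLie) n :
  chi_prelie (hat_mul x y n) =
  \sum_(m < n.+1) chi_prelie (x m) * chi_prelie (y 0%N) ^+ m * chi_prelie (y (n - m)%N).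
Proof.
exact: chi_hat_mul prelie_coef_comp prelie_coef_linear prelie_corolla_sum_act _ _ _.
Qed.

Lemma chi_mu_hat_mul (x y : hat Mu) n :
  chi_mu (hat_mul x y n) =
  \sum_(m < n.+1) chi_mu (x m) * chi_mu (y 0%N) ^+ m * chi_mu (y (n - m)%N).
Proof.
exact: chi_hat_mul mu_coef_comp mu_coef_linear mu_corolla_sum_act _ _ _.
Qed.

Lemma chi_prelie_hat_one n : chi_prelie (hat_one PreLie n) = fps_one n.
Proof.
rewrite (chi_hat_of prelie_coef_linear prelie_corolla_sum_act) eqSS eq_sym /fps_one.
rewrite [op_unit _](_ : _ = tvec (corolla_at ord0))
  ?corolla_sum_tvec_corolla_at ?mulr1 // -corollaE.
Qed.

Lemma chi_mu_hat_one n : chi_mu (hat_one Mu n) = fps_one n.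
Proof.
rewrite (chi_hat_of mu_coef_linear mu_corolla_sum_act) eqSS eq_sym /fps_one.
rewrite [corolla_sum _ _](_ : _ = 1) ?mulr1 // -(corolla_sum_tvec_corolla_at (@ord0 0))
  -corollaE.
by apply: eq_bigr => r _; apply: mu_coefE.
Qed.

Lemma coinv_mu_inj m (p q : coinv Mu m.+1) : chi_mu p = chi_mu q -> p = q.
Proof. by move=> e; rewrite (coinv_mu_span p) e -coinv_mu_span. Qed.

Lemma chi_prelie_exp_star n : chi_prelie (exp_star n) = expm1_over_x n.
Proof.
rewrite chi_prelieZ chi_prelie_vpow mulr1 /expm1_over_x /fps_divX /fps_sub /fps_exp /fps_one.
by rewrite subr0.
Qed.

Lemma fps_mulC f g n : fps_mul f g n = fps_mul g f n.
Proof.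
rewrite /fps_mul (reindex_inj rev_ord_inj) /=; apply: eq_bigr => i _.
have e : (n.+1 - i.+1 = n - i)%N by rewrite subSS.
have e' : (n - (n.+1 - i.+1) = i)%N by rewrite subSS subKn // -ltnS ltn_ord.
by rewrite e' e; exact: mulrC.
Qed.

Definition of_fps (f : fps) : hat Mu := fun m => f m *: nu m.

Lemma chi_mu_of_fps f n : chi_mu (of_fps f n) = f n.
Proof. by rewrite chi_muZ chi_mu_nu mulr1. Qed.

Lemma hat_mul_of_fps f g : g 0%N = 1 ->
  fps_mul f g =1 fps_one -> hat_mul (of_fps f) (of_fps g) = hat_one Mu.
Proof.
move=> g0 fg; apply/functional_extensionality_dep => n; apply: coinv_mu_inj.
rewrite chi_mu_hat_mul chi_mu_hat_one -fg; apply: eq_bigr => m _.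
by rewrite !chi_mu_of_fps g0 expr1n mulr1.
Qed.

Lemma of_fps_corresponds f g : f 0%N = 1 -> g 0%N = 1 ->
  fps_mul f g =1 fps_one -> G_Mu_corresponds (of_fps f) 1 f.
Proof.
move=> f0 g0 fg; split=> //.
  exists (of_fps g); split; apply: hat_mul_of_fps => // n.
  by rewrite fps_mulC.
by apply/functional_extensionality_dep => m; rewrite scale1r.
Qed.

Lemma psi_of_fps (x : hat PreLie) f : (forall n, chi_prelie (x n) = f n) ->
  psi x = of_fps f.
Proof.
move=> xf; apply/functional_extensionality_dep => n; apply: coinv_mu_inj.
by rewrite chi_mu_psi chi_mu_of_fps.
Qed.

Lemma expm1_over_x0 : expm1_over_x 0%N = 1.
Proof. by []. Qed.

Lemma psi_exp_star : G_Mu_corresponds (psi exp_star) 1 expm1_over_x.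
Proof.
rewrite (psi_of_fps chi_prelie_exp_star); apply: (@of_fps_corresponds _ x_over_expm1) => // n.
by rewrite fps_mulC; apply: fps_mulVf.
Qed.

(** The coefficients of [g] are recovered one after the other, as [f] has constant
    term 1. *)
Lemma fps_mul_inj f g h : f 0%N = 1 -> fps_mul f g =1 fps_mul f h -> g =1 h.
Proof.
move=> f0 e n; elim/ltn_ind: n => n IH.
have := e n; rewrite /fps_mul !big_ord_recl f0 !mul1r subn0.
rewrite [X in _ + X = _](_ : _ = \sum_(i < n) f (lift ord0 i) * h (n - lift ord0 i)%N).
  by move/addIr.
apply: eq_bigr => i _; rewrite IH // /bump /= ltn_subrL /=.
by case: (n) i => // -[].
Qed.

(** In arity one the equation forces [chi (log_star 0)] to be 1; the powers of this
    number then disappear from the product formula, which becomes the product of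
    series. *)
Lemma psi_log_star (log_star : hat PreLie) : hat_inverse exp_star log_star ->
  G_Mu_corresponds (psi log_star) 1 x_over_expm1.
Proof.
move=> [el _].
have hl n : \sum_(m < n.+1) expm1_over_x m * chi_prelie (log_star 0%N) ^+ m *
             chi_prelie (log_star (n - m)%N) = fps_one n.
  rewrite -chi_prelie_hat_one -el chi_prelie_hat_mul.
  by apply: eq_bigr => m _; rewrite chi_prelie_exp_star.
have l0 : chi_prelie (log_star 0%N) = 1.
  by have := hl 0%N; rewrite big_ord1 expr0 mulr1 expm1_over_x0 mul1r.
rewrite (@psi_of_fps _ x_over_expm1); last first.
  apply: (@fps_mul_inj expm1_over_x) => // n.
  rewrite [RHS]fps_mulC fps_mulVf // -hl; apply: eq_bigr => m _.
  by rewrite l0 expr1n mulr1.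
apply: (@of_fps_corresponds _ expm1_over_x) => // n.
exact: fps_mulVf.
Qed.


(** * Classes of trees on arbitrary finite sets *)

(** Zero if [p] is not a tree.  Parent functions can thus be transported along
    bijections without carrying along a proof that they are trees. *)
Definition pvec n (p : 'I_n -> option 'I_n) : PreLie n :=
  [ffun T : tree n => [forall v, par T v == p v]%:R] : prelie_space n.

Lemma pvec_tree n (T : tree n) : pvec (par T) = tvec T.
Proof.
apply/ffunP => S; rewrite !ffunE; congr (_%:R); congr nat_of_bool.
apply/forallP/eqP => [h|-> //]; apply/par_inj/ffunP => v.
by apply/eqP.
Qed.

Lemma eq_pvec n (p p' : 'I_n -> option 'I_n) : p =1 p' -> pvec p = pvec p'.
Proof.
move=> e; apply/ffunP => S; rewrite !ffunE; congr (_%:R); congr nat_of_bool.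
by apply: eq_forallb => v; rewrite e.
Qed.

Lemma pvec_act n (s : 'S_n) p :
  prelie_act s (pvec p) = pvec (fun v => omap s (p (s^-1%g v))).
Proof.
apply/ffunP => S; rewrite prelie_actE !ffunE; congr (_%:R); congr nat_of_bool.
apply/forallP/forallP => h v.
  have := h (s^-1%g v); rewrite [par _ _]ffunE invgK permKV => /eqP <-.
  by case: (par S v) => //= w; rewrite permKV.
rewrite [par _ _]ffunE invgK; have := h (s v); rewrite permK => /eqP ->.
by case: (p v) => //= w; rewrite permK.
Qed.

Lemma to_coinv_act n (s : 'S_n) (x : PreLie n) :
  to_coinv (op_act PreLie s x) = to_coinv x.
Proof. by apply/clsP/in_span_gen; exists s, x. Qed.

Section TreeClass.
Variable n : nat.

Definition push (V V' : Type) (h : V -> V') (h' : V' -> V) (p : V -> option V) :=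
  fun v => omap h (p (h' v)).

(** Zero if the number of vertices is not [n], so that sums over all arities can be
    written without casts.  The enumeration of [V] does not matter in the
    coinvariants, see [tree_classE]. *)
Definition tree_class (V : finType) (p : V -> option V) : coinv PreLie n :=
  match @eqP _ #|V| n with
  | ReflectT e => to_coinv (pvec
      (push (fun v => cast_ord e (enum_rank v)) (fun i => enum_val (cast_ord (esym e) i)) p))
  | ReflectF _ => 0
  end.

Lemma tree_classE (V : finType) (p : V -> option V) (h : V -> 'I_n) h' :
  cancel h h' -> cancel h' h -> tree_class p = to_coinv (pvec (push h h' p)).
Proof.
move=> hK h'K; have cV : #|V| = n by rewrite -[RHS](card_ord n); apply: bij_eq_card; exists h'.
rewrite /tree_class; case: eqP => [e|//]; set g := fun v => _; set g' := fun i => _.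
have gK : cancel g g' by move=> v; rewrite /g /g' cast_ordK enum_rankK.
have g'K : cancel g' g by move=> v; rewrite /g /g' enum_valK cast_ordKV.
(* the two enumerations of [V] differ by a permutation *)
have si : injective (h \o g') by apply: inj_comp; apply: can_inj; eauto.
rewrite -(to_coinv_act (perm si)) [op_act _ _ _]pvec_act; congr to_coinv.
apply: eq_pvec => v; rewrite /push.
have -> : (perm si)^-1%g v = g (h' v).
  by apply: (@perm_inj _ (perm si)); rewrite permKV permE /= gK h'K.
by rewrite gK; case: (p _) => //= w; rewrite permE /= gK.
Qed.

Lemma tree_class_card (V : finType) (p : V -> option V) : #|V| <> n -> tree_class p = 0.
Proof. by rewrite /tree_class; case: eqP. Qed.

Lemma tree_class_iso (V V' : finType) (p : V -> option V) (p' : V' -> option V') h h' :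
  cancel h h' -> cancel h' h -> (forall v, p' (h v) = omap h (p v)) ->
  tree_class p = tree_class p'.
Proof.
move=> hK h'K pp'.
have cVV : #|V| = #|V'| by apply: bij_eq_card; exists h'.
have [e|ne] := eqVneq #|V'| n; last by rewrite !tree_class_card ?cVV //; apply/eqP.
pose g v : 'I_n := cast_ord e (enum_rank v); pose g' i : V' := enum_val (cast_ord (esym e) i).
have gK : cancel g g' by move=> v; rewrite /g /g' cast_ordK enum_rankK.
have g'K : cancel g' g by move=> v; rewrite /g /g' enum_valK cast_ordKV.
rewrite (tree_classE p' gK g'K) (tree_classE p (can_comp gK hK) (can_comp h'K g'K)).
congr to_coinv; apply: eq_pvec => v; rewrite /push /=.
by rewrite -[g' v]h'K pp' h'K; case: (p _).
Qed.

Lemma eq_tree_class (V : finType) (p p' : V -> option V) : p =1 p' -> tree_class p =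
  tree_class p'.
Proof.
by move=> e; apply: (@tree_class_iso _ _ _ _ id id) => // v; rewrite e; case: (p' v).
Qed.

Lemma tree_class_tree (T : tree n) : tree_class (par T) = to_coinv (tvec T : PreLie n).
Proof.
rewrite (@tree_classE _ _ id id) // -pvec_tree; congr to_coinv; apply: eq_pvec => v.
by rewrite /push; case: (par T v).
Qed.

End TreeClass.

Lemma tree_class_hat_of n k (T : tree k) : tree_class n.+1 (par T) =
  hat_of (tvec T : PreLie k) n.
Proof.
rewrite /hat_of; case: eqP => [e|ne]; last by rewrite tree_class_card // card_ord.
by subst k; rewrite tree_class_tree.
Qed.


(** * Fibres, and sums over the blow-ups of a tree *)

Definition ltree := {d : nat & tree d}.

Section Fibre.
Variables (V W : finType) (pi : W -> V) (q : W -> option W).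

(** [S] is the forest [q] restricted to the fibre over [v].  The numbering of the
    fibre by [S] is only asserted to exist, so that the same property serves for
    disjoint unions, for collapsed trees and for composites. *)
Definition has_fibre (v : V) (S : ltree) : Prop :=
  exists s : 'I_(tag S) -> W, exists t : W -> 'I_(tag S),
  [/\ cancel s t, forall x, pi (s x) = v, forall w, pi w = v -> s (t w) = w
    & forall x, q (s x) = omap s (par (tagged S) x)].

End Fibre.

(** The numberings of the fibres of two such sets can be composed fibrewise. *)
Lemma fibre_iso (V W W' : finType) (pi : W -> V) q (pi' : W' -> V) q' (G : V -> ltree) :
  (forall v, has_fibre pi q v (G v)) -> (forall v, has_fibre pi' q' v (G v)) ->
  exists h, exists h', [/\ cancel h h', cancel h' h, forall w, pi' (h w) = pi w
     & forall w, q' (h w) = omap h (q w)].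
Proof.
move=> /fin_all_exists [s] /fin_all_exists [t] st.
move=> /fin_all_exists [s'] /fin_all_exists [t'] st'.
pose h w := s' (pi w) (t (pi w) w); pose h' w := s (pi' w) (t' (pi' w) w).
have pih w : pi' (h w) = pi w by case: (st' (pi w)) => _ + _ _; apply.
have pih' w : pi (h' w) = pi' w by case: (st (pi' w)) => _ + _ _; apply.
exists h, h'; split=> // [w|w|w].
- rewrite /h' pih /h; case: (st' (pi w)) => -> _ _ _.
  by case: (st (pi w)) => _ _ + _; apply.
- rewrite /h pih' /h'; case: (st (pi' w)) => -> _ _ _.
  by case: (st' (pi' w)) => _ _ + _; apply.
- rewrite {1}/h; case: (st' (pi w)) => _ _ _ ->.
  case: (st (pi w)) => tK piv sK qs.
  rewrite -[in RHS](sK w erefl) qs; case: (par _ _) => //= x.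
  by rewrite /h piv tK.
Qed.

Section BlowSum.
Variable n : nat.

Definition fibre_union (V : finType) (G : V -> ltree) : finType := {v : V & 'I_(tag (G v))}.

Definition fibre_par (V : finType) (G : V -> ltree)
  (w : fibre_union G) : option (fibre_union G) :=
  omap (Tagged (fun v => 'I_(tag (G v)))) (par (tagged (G (tag w))) (tagged w)).

Definition blowup_sum (V : finType) (p : V -> option V) (G : V -> ltree) : coinv PreLie n :=
  \sum_(P : {ffun fibre_union G -> option (fibre_union G)} | blowup tag (@fibre_par V G)
    p P) tree_class n P.

Lemma fibre_std (V : finType) (G : V -> ltree) v : has_fibre (W := fibre_union G)
  tag (@fibre_par V G) v (G v).
Proof.
have [r _ _] := is_treeP _ (valP (tagged (G v))).
pose T := fun v => 'I_(tag (G v)).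
exists (fun x => Tagged T x); exists (fun w : fibre_union G => tagged_as (Tagged T r) w);
  split=> //.
- by move=> x; rewrite tagged_asE.
- by case=> u x /= e; subst u; rewrite tagged_asE.
Qed.

(** The canonical disjoint union may be replaced by any set over [V] with the same
    fibres; this is how isomorphisms between sets of vertices are handled below. *)
Lemma blowup_sumE (V W : finType) (p : V -> option V) (G : V -> ltree) (pi : W -> V) q :
  (forall v, has_fibre pi q v (G v)) ->
  blowup_sum p G = \sum_(P : {ffun W -> option W} | blowup pi q p P) tree_class n P.
Proof.
move=> hW; have [h [h' [hK h'K pih qh]]] := fibre_iso (@fibre_std V G) hW.
pose f (P : {ffun W -> option W}) : {ffun fibre_union G -> option (fibre_union G)} :=
  [ffun w => push h' h P w].
pose f' (P : {ffun fibre_union G -> option (fibre_union G)}) : {ffun W -> option W} :=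
  [ffun w => push h h' P w].
have fK : cancel f f'.
  by move=> P; apply/ffunP => w; rewrite !ffunE /push ffunE /push h'K;
    case: (P w) => //= u; rewrite h'K.
have f'K : cancel f' f.
  by move=> P; apply/ffunP => w; rewrite !ffunE /push ffunE /push hK; case: (P w) => //= u;
    rewrite hK.
rewrite /blowup_sum (reindex f) /=; last by exists f' => x _; [apply: fK|apply: f'K].
apply: eq_big => [P|P _]; last first.
  apply: (tree_class_iso _ hK h'K) => w; rewrite ffunE /push.
  by case: (P (h w)) => //= u; rewrite h'K.
apply/blowupP/blowupP => H w.
  have := H (h' w); have := qh (h' w); rewrite h'K ffunE /push h'K => ->.
  case: (fibre_par (h' w)) => /= [w'|].
    by case: (P w) => //= u [<-]; rewrite h'K.
  rewrite -(pih (h' w)) h'K => <-; case: (P w) => //= u.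
  by rewrite -pih h'K.
have := H (h w); rewrite qh ffunE /push.
case: (fibre_par w) => /= [w' ->|]; first by rewrite /= hK.
rewrite pih => <-; case: (P _) => //= u; by rewrite -pih h'K.
Qed.

End BlowSum.


(** * Composition of blow-ups *)

Section BlowComp.
Variables (V U W : finType) (pi1 : U -> V) (q1 : U -> option U).
Variables (pi2 : W -> U) (q2 q : W -> option W).
Hypothesis root2 : forall u, exists w, [/\ pi2 w = u, q2 w = None
  & forall w', pi2 w' = u -> q2 w' = None -> w' = w].
Hypothesis q_some : forall w w', q2 w = Some w' -> q w = Some w'.
Hypothesis q_none : forall w, q2 w = None -> q1 (pi2 w) = None -> q w = None.
Hypothesis q_lift : forall w u, q2 w = None -> q1 (pi2 w) = Some u ->
  exists w', [/\ q w = Some w', pi2 w' = u & forall w'', pi2 w'' = u -> w'' = w'].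

(** The intermediate parent function can be read off at the roots of the fibres. *)
Lemma blowup_comp_inj P1 P1' (P : W -> option W) :
  blowup pi2 q2 P1 P -> blowup pi2 q2 P1' P -> P1 =1 P1'.
Proof.
move=> /blowupP b /blowupP b' u; have [w [<- qw _]] := root2 u.
by have := b w; have := b' w; rewrite qw => <- <-.
Qed.

Lemma blowup_compW p P1 P :
  blowup pi1 q1 p P1 -> blowup pi2 q2 P1 P -> blowup (pi1 \o pi2) q p P.
Proof.
move=> /blowupP b1 /blowupP b2; apply/blowupP => w; have := b2 w.
case e2: (q2 w) => [w'|]; first by rewrite (q_some e2).
have := b1 (pi2 w); case e1: (q1 _) => [u|].
  have [w' [-> pw' uw']] := q_lift e2 e1; move=> ->.
  by case: (P w) => //= w'' [/uw' ->].
by rewrite (q_none e2 e1) => <- <-; case: (P w).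
Qed.

Lemma blowup_comp_ex p P : blowup (pi1 \o pi2) q p P ->
  exists P1 : {ffun U -> option U}, blowup pi1 q1 p P1 && blowup pi2 q2 P1 P.
Proof.
move=> /blowupP b.
(* the root of the fibre over [u] *)
pose rt u := sval (cid (root2 u)).
have rtP u : [/\ pi2 (rt u) = u, q2 (rt u) = None
  & forall w', pi2 w' = u -> q2 w' = None -> w' = rt u] by rewrite /rt; case: cid.
exists [ffun u => omap pi2 (P (rt u))]; apply/andP; split; apply/blowupP.
  move=> u; have [pu qu _] := rtP u; rewrite ffunE; have := b (rt u).
  case e1: (q1 u) => [u'|].
    rewrite -pu in e1; have [w' [-> <- _]] := q_lift qu e1.
    by move=> ->.
  rewrite -pu in e1; rewrite (q_none qu e1) /= pu => <-.
  by case: (P _).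
move=> w; case e2: (q2 w) => [w'|]; first by have := b w; rewrite (q_some e2).
by rewrite ffunE; have [_ _ h] := rtP (pi2 w); rewrite -(h w erefl e2).
Qed.

(** The forest [q] of the composite is made of the edges of [q2] and of lifts of the
    edges of [q1].  By [q_lift] such an edge ends in a fibre with one vertex, so
    that its lift is unique. *)
Lemma sum_blowup_comp (R : nmodType) p (F : {ffun W -> option W} -> R) :
  \sum_(P1 : {ffun U -> option U} | blowup pi1 q1 p P1)
    \sum_(P : {ffun W -> option W} | blowup pi2 q2 P1 P) F P =
  \sum_(P : {ffun W -> option W} | blowup (pi1 \o pi2) q p P) F P.
Proof.
rewrite (exchange_big_dep (fun P : {ffun W -> option W} => blowup (pi1 \o pi2) q p P)) /=.
  apply: eq_bigr => P /blowup_comp_ex [P1 bP1]; rewrite (bigD1 P1) //= big1 ?addr0 //.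
  move=> P1' /andP [/andP [_ b'] ne]; case/negP: ne; apply/eqP/ffunP.
  by case/andP: bP1 => _; apply: blowup_comp_inj.
by move=> P1 P; apply: blowup_compW.
Qed.

End BlowComp.

Lemma tree_root_uniq n (T : tree n) :
  exists r, par T r = None /\ forall r', par T r' = None -> r' = r.
Proof.
have [r pr cr] := is_treeP _ (valP T); exists r; split=> // r' pr'.
have /connectP [[|w s] //= /andP [/eqP]] := cr r'.
by move: pr'; rewrite /par => ->.
Qed.

Lemma fibre_root (V W : finType) (pi : W -> V) q v S : has_fibre pi q v S ->
  exists w, [/\ pi w = v, q w = None & forall w', pi w' = v -> q w' = None -> w' = w].
Proof.
move=> [s [t [_ ps st qs]]]; have [r [pr rr]] := tree_root_uniq (tagged S).
exists (s r); split=> [||w' pw' qw']; first exact: ps.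
  by rewrite qs pr.
rewrite -(st _ pw') in qw' *; rewrite qs in qw'; congr s; apply: rr.
by case: (par _ _) qw'.
Qed.

Definition ltree1 : ltree := Tagged tree one_vertex.

(** The inputs [v >= a] are left empty, which amounts to filling them with
    [ltree1]. *)
Definition pad (a : nat) (g : nat -> ltree) (v : nat) : ltree :=
  if (v < a)%N then g v else ltree1.

Section Step.
Variables (a b : nat) (g : nat -> ltree).
Notation n := (tag (g a)).
Notation S := (tagged (g a)).
Variables (W : finType) (pi : W -> 'I_(a.+1 + b)) (q : W -> option W).
Hypothesis hW : forall v, has_fibre pi q v (pad a.+1 g v).

Lemma pad_ins (j : 'I_(a.+1 + b)) u : ins_T n j = Some u -> pad a g u = pad a.+1 g j.
Proof.
rewrite /ins_T /pad; case: (splitP j) => [k jk|k jk].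
  case: (unliftP ord_max k) => //= l kl [<-] /=.
  by have la := ltn_ord l; rewrite jk kl lift_max la.
by move=> [<-]; rewrite /= ltnNge leq_addr.
Qed.

(** A set with the fibres [g 0, .., g a] over the vertices of a tree is also a set
    over the vertices of that tree with [g a] inserted: the fibre over [slot] is
    spread out into fibres with one vertex, and [q2] forgets its edges. *)
Lemma fibre_spread : exists (pi2 : W -> 'I_(a + (n + b))) q2,
  [/\ forall u, has_fibre pi2 q2 u (pad a g u), pi =1 @ins_proj a b n \o pi2,
   forall w w', q2 w = Some w' -> q w = Some w',
   forall w, q2 w = None -> ins_par S (pi2 w) = None -> q w = None
   & forall w u, q2 w = None -> ins_par S (pi2 w) = Some u ->
     exists w', [/\ q w = Some w', pi2 w' = u & forall w'', pi2 w'' = u -> w'' = w']].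
Proof.
have := hW (slot a b); rewrite {1}/pad /= ltnSn => -[s [t [sK ps st qs]]].
(* [s] numbers the fibre over [slot] and [t] is its inverse; the vertices of this
   fibre become the vertices of the inserted tree *)
pose pi2 w := if ins_T n (pi w) is Some u then u else ins_S a b (t w).
pose q2 w := if pi w == slot a b then None else q w.
have pi2s x : pi2 (s x) = ins_S a b x by rewrite /pi2 ps ins_T_slot sK.
have pi2K w : ins_proj (pi2 w) = pi w.
  rewrite /pi2; have [->|ns] := eqVneq (pi w) (slot a b).
    by rewrite ins_T_slot ins_projS.
  by have [u eu] := ins_T_some n ns; rewrite eu (ins_projT eu).
have pi2S w x : pi2 w = ins_S a b x -> w = s x.
  move=> e; have pw : pi w = slot a b by rewrite -pi2K e ins_projS.
  by have := e; rewrite -[in LHS](st w pw) pi2s => /ins_S_inj <-; rewrite st.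
have pi2T w j u : ins_T n j = Some u -> pi2 w = u <-> pi w = j.
  move=> ju; split=> [e|e]; first by rewrite -pi2K e (ins_projT ju).
  by rewrite /pi2 e ju.
exists pi2, q2; split=> [u|w|w w'|w|w u].
- have := ins_vertexP u; case: (ins_vertex u) => [j ju|x ->].
    rewrite (pad_ins ju); have [s' [t' [sK' ps' st' qs']]] := hW j.
    exists s', t'; split=> // [x|w|x].
    + by apply/(pi2T _ _ _ ju).
    + by move/(pi2T _ _ _ ju); apply: st'.
    rewrite /q2 ps' ifN ?qs' //; apply/eqP => e.
    by rewrite e ins_T_slot in ju.
  have -> : pad a g (ins_S a b x) = ltree1 by rewrite /pad /= ltnNge leq_addr.
  exists (fun=> s x), (fun=> ord0); split=> [y|y|w|y].
  + by rewrite (ord1 y).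
  + exact: pi2s.
  + by move/pi2S.
  by rewrite /q2 ps eqxx (ord1 y) /= ffunE eqxx.
- by rewrite /= pi2K.
- by rewrite /q2; case: ifP.
- rewrite /q2; case: eqP => // pw _; rewrite -(st w pw) pi2s.
  by rewrite /ins_par ins_vertexS qs; case: (par _ _).
- move=> _; rewrite /ins_par; have := ins_vertexP (pi2 w).
  case: (ins_vertex _) => // x /pi2S ->.
  rewrite qs; case: (par S x) => //= x' [<-].
  exists (s x'); split=> // w''; exact: pi2S.
Qed.

End Step.


(** * Iterated insertions are sums over blow-ups *)

Lemma prelie_comp_tvec a b n (T : tree (a.+1 + b)) (S : tree n) :
  prelie_comp (tvec T) (tvec S) =
  \sum_(T' | blowup (@ins_proj a b n) (ins_par S) (par T) (par T')) tvec T'.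
Proof.
pose B T0 S0 T' := blowup (@ins_proj a b n) (ins_par (S0 : tree n)) (par T0) (par T').
apply/ffunP => T'; rewrite prelie_compE sum_ffunE; transitivity ((B T S T')%:R : rat).
  rewrite -[RHS](@sum_mul_eq _ (fun T0 => (B T0 S T')%:R) T).
  apply: eq_bigr => T0 _.
  rewrite -[X in _ = X * _](@sum_mul_eq _ (fun S0 => (B T0 S0 T')%:R) S).
  rewrite mulr_suml; apply: eq_bigr => S0 _; rewrite !ffunE /B.
  by rewrite mulrC -mulrA [X in _ * X]mulrC.
rewrite big_mkcond -[LHS](@sum_mul_eq _ (fun T0 => (B T S T0)%:R) T').
apply: eq_bigr => T0 _; rewrite eq_sym /B; case: ifP => _; first by rewrite ffunE mul1r.
by rewrite mul0r.
Qed.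

Lemma prelie_comp_linear a b n (y : prelie_space n) :
  linear (fun x : prelie_space (a.+1 + b) => prelie_comp x y).
Proof.
move=> k x x'; apply/ffunP => T'; rewrite !ffunE !prelie_compE.
rewrite scaler_sumr -big_split; apply: eq_bigr => T _.
rewrite scaler_sumr -big_split; apply: eq_bigr => S _.
by rewrite !ffunE !mulrDl /GRing.scale /= !mulrA.
Qed.

(** Only trees occur on the right-hand side, since blow-ups are insertions. *)
Lemma sum_tree_blowup (R : nmodType) a b n (T : tree (a.+1 + b)) (S : tree n)
    (F : parent_fun (a + (n + b)) -> R) :
  \sum_(T' | blowup (@ins_proj a b n) (ins_par S) (par T) (par T')) F (par T') =
  \sum_(P : {ffun 'I_(a + (n + b)) -> option 'I_(a + (n + b))} |
     blowup (@ins_proj a b n) (ins_par S) (par T) P) F P.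
Proof.
rewrite [RHS](reindex_omap (@par (a + (n + b))) insub) /=.
  by apply: eq_bigl => T'; rewrite /par valK eqxx andbT.
by move=> P /blowup_insert [f ->]; rewrite (insubT _ (insert_is_tree S f)).
Qed.

Section Gam.
Variables (n : nat) (g : nat -> ltree).

(** The recursion of [gamma] for labeled trees, followed by the projection to the
    coinvariants in arity [n + 1]. *)
Fixpoint fill_with (a b : nat) : PreLie (a + b) -> coinv PreLie n.+1 :=
  match a return PreLie (a + b) -> coinv PreLie n.+1 with
  | 0 => fun x => hat_of x n
  | a'.+1 => fun x =>
     @fill_with a' (tag (g a') + b)
       (@op_comp PreLie a' b _ x (tvec (tagged (g a')) : PreLie _))
  end.

Lemma fill_with_linear a b : linear (@fill_with a b).
Proof.
elim: a b => [|a IH] b k x y /=; first exact: (@hat_of_linear PreLie b n k x y).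
by rewrite -IH; congr fill_with; exact: prelie_comp_linear.
Qed.

(** The tree inserted last in the recursion sits on the unfilled inputs of the next
    step; [fibre_spread] and [sum_blowup_comp] merge the two blow-ups. *)
Lemma fill_withE a b (T : tree (a + b)) :
  @fill_with a b (tvec T) = blowup_sum n.+1 (par T) (fun v => pad a g v).
Proof.
elim: a b T => [|a IH] b T /=.
  rewrite -tree_class_hat_of (@blowup_sumE _ _ _ _ _ id (fun=> None)).
    rewrite (bigD1 (par T)) /=; last by apply/blowupP => w; rewrite omap_id.
    rewrite big1 ?addr0 // => P /andP [/blowupP bP nP]; case/eqP: nP.
    by apply/ffunP => w; have := bP w; rewrite omap_id.
  move=> v; exists (fun=> v), (fun=> ord0); split=> // x; first by rewrite (ord1 x).
  by rewrite /= ffunE (ord1 x).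
rewrite prelie_comp_tvec.
pose G (v : 'I_(a.+1 + b)) := pad a.+1 g v.
have [pi2 [q2 [hW hpi hs hn hl]]] := fibre_spread (@fibre_std _ G).
transitivity (\sum_(T' | blowup (@ins_proj a b _) (ins_par (tagged (g a))) (par T) (par T'))
    blowup_sum n.+1 (par T') (fun v => pad a g v)).
  rewrite -big_filter -[in RHS]big_filter.
  elim: (filter _ _) => [|T' s IHs]; first by rewrite !big_nil (linear_zero
    (@fill_with_linear _ _)).
  by rewrite !big_cons -IHs -IH -[tvec T']scale1r fill_with_linear !scale1r.
rewrite (sum_tree_blowup T (tagged (g a)) (fun P => blowup_sum n.+1 P (fun v => pad a g v))).
under eq_bigr => P1 _ do rewrite (blowup_sumE _ _ hW).
rewrite (@sum_blowup_comp _ _ _ _ _ _ _ _ (fun u => fibre_root (hW u)) hs hn hl).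
apply: eq_bigl => P; apply/blowupP/blowupP => bP w; have := bP w;
  case: (fibre_par w) => [//|]; by rewrite (eq_omap hpi) hpi.
Qed.

End Gam.


(** * The product of the completion as a substitution in trees *)

Lemma prelie_comp_linear2 a b n (x : prelie_space (a.+1 + b)) :
  linear (fun y : prelie_space n => prelie_comp x y).
Proof.
move=> k y y'; apply/ffunP => T'; rewrite !ffunE !prelie_compE.
rewrite scaler_sumr -big_split; apply: eq_bigr => T _.
rewrite scaler_sumr -big_split; apply: eq_bigr => S _.
by rewrite !ffunE mulrDr !mulrDl /GRing.scale /= !mulrA [x T * k]mulrC.
Qed.

Section Expansion.
Variables (y : hat PreLie) (n : nat).

Definition hat_gamma_at (k : nat -> nat) a b (x : PreLie (a + b)) : coinv PreLie n.+1 :=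
  hat_of (@gamma PreLie a b x (fun i => (k i).+1) (fun i => of_coinv (y (k i)))) n.

Lemma hat_gamma_at_ext k k' a b (x : PreLie (a + b)) :
  (forall i, (i < a)%N -> k i = k' i) -> hat_gamma_at k x = hat_gamma_at k' x.
Proof.
elim: a b x => [|a IH] b x kk'; first by [].
rewrite -[hat_gamma_at k x]/(@hat_gamma_at k a _ (op_comp PreLie (x : PreLie (a.+1 + b))
  (of_coinv (y (k a))))).
rewrite IH => [|i ia]; last by rewrite kk' // ltnW.
by rewrite kk'.
Qed.

Lemma hat_gamma_atS k c a b (x : PreLie (a.+1 + b)) : k a = c ->
  @hat_gamma_at k a.+1 b x = @hat_gamma_at k a (c.+1 + b)
    (@op_comp PreLie a b _ x (of_coinv (y c))).
Proof. by move=> <-. Qed.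

Lemma hat_gamma_at_linear k a b : linear (@hat_gamma_at k a b).
Proof.
elim: a b => [|a IH] b c x x'; first exact: (@hat_of_linear PreLie b n c x x').
rewrite -![@hat_gamma_at k a.+1 b _]/(@hat_gamma_at k a _ (op_comp PreLie (_ : PreLie (a.+1
  + b)) (of_coinv (y (k a))))).
by rewrite -IH; congr hat_gamma_at; exact: prelie_comp_linear.
Qed.

(** The sum of [hat_gamma_at] over all tuples of arities, with the representatives
    of [y] expanded in the basis of trees. *)
Fixpoint fill (N a b : nat) : PreLie (a + b) -> coinv PreLie n.+1 :=
  match a return PreLie (a + b) -> coinv PreLie n.+1 with
  | 0 => fun x => hat_of x n
  | a'.+1 => fun x => \sum_(c < N) \sum_(S : tree c.+1)
      (of_coinv (y c) : prelie_space c.+1) S *: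
      @fill N a' (c.+1 + b) (@op_comp PreLie a' b _ x (tvec S : PreLie _))
  end.

(** [gamma] fills in the last input first, so the tuples are split at their last
    entry. *)
Lemma sum_gamma N a b (x : PreLie (a + b)) :
  \sum_(k : a.-tuple 'I_N.+1) hat_gamma_at (fun i => nth ord0 k i) x = @fill N.+1 a b x.
Proof.
elim: a b x => [|a IH] b x.
  rewrite (bigD1 [tuple]) //= big1 ?addr0 // => k /eqP [].
  exact: tuple0.
rewrite (sum_tuple_rcons ord0) /=; apply: eq_bigr => c _.
transitivity (\sum_(k : a.-tuple 'I_N.+1) \sum_(S : tree c.+1)
   (of_coinv (y c) : prelie_space c.+1) S *: @hat_gamma_at (fun i => nth ord0 k i) a (c.+1 + b)
      (@op_comp PreLie a b _ x (tvec S : PreLie _))).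
  apply: eq_bigr => k _; rewrite (@hat_gamma_atS _ c); last first.
    by rewrite nth_rcons size_tuple ltnn eqxx.
  rewrite (@hat_gamma_at_ext _ (fun i => nth ord0 k i)); last first.
    by move=> i ia; rewrite nth_rcons size_tuple ia.
  rewrite [of_coinv _ in LHS]tvecE [op_comp _ _ _](linear_big _ (prelie_comp_linear2 _)).
  rewrite (linear_big _ (@hat_gamma_at_linear _ _ _)); apply: eq_bigr => S _.
  rewrite [prelie_comp _ _](linear_scale _ _ (prelie_comp_linear2 _)).
  exact: (linear_scale _ _ (@hat_gamma_at_linear _ _ _)).
rewrite exchange_big; apply: eq_bigr => S _ /=.
by rewrite -IH scaler_sumr.
Qed.

Lemma fill_zero N a b (x : PreLie (a + b)) : (n.+1 < a + b)%N -> @fill N a b x = 0.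
Proof.
elim: a b x => [|a IH] b x nab /=.
  by rewrite /hat_of; case: eqP => // e; rewrite [X in (_ < X)%N]e ltnn in nab.
rewrite big1 // => c _; rewrite big1 // => S _; rewrite IH ?scaler0 //.
by rewrite (leq_trans nab) // addSnnS leq_add2l addSn ltnS leq_addl.
Qed.

(** Trees with more than [n + 1] vertices do not contribute in arity [n + 1].  A
    common bound for all arities is needed to compare the two sides of the
    morphism property. *)
Lemma fill_bound N a b (x : PreLie (a + b)) : (n < N)%N ->
  @fill N a b x = @fill n.+1 a b x.
Proof.
move=> nN; elim: a b x => [//|a IH] b x /=.
pose f (c : nat) := \sum_(S : tree c.+1) (of_coinv (y c) : prelie_space c.+1) S *:
      @fill n.+1 a (c.+1 + b) (@op_comp PreLie a b _ x (tvec S : PreLie _)).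
transitivity (\sum_(c < N) f c).
  by apply: eq_bigr => c _; apply: eq_bigr => S _; rewrite IH.
rewrite -[RHS]/(\sum_(c < n.+1) f c) -!(big_mkord xpredT f).
rewrite (big_cat_nat (n := n.+1)) //= [X in _ + X]big1_seq ?addr0 // => c.
rewrite mem_index_iota => /andP [_ /andP [nc _]]; apply: big1 => S _.
rewrite fill_zero ?scaler0 // addSn addnS ltnS.
by rewrite (leq_trans nc) // addnCA leq_addr.
Qed.

(** Bounding the number of vertices gives a finite type, over which one can sum. *)
Definition btree N := {c : 'I_N & tree c.+1}.

Definition btree_val N (S : btree N) : ltree := existT tree (tag S).+1 (tagged S).

Definition weight N (S : btree N) : rat :=
  (of_coinv (y (tag S)) : prelie_space (tag S).+1) (tagged S).

Definition pad_ffun N a (G : {ffun 'I_a -> btree N}) (i : nat) : ltree :=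
  if insub i is Some j then btree_val (G j) else ltree1.

Lemma fill_with_ext g g' a b (x : PreLie (a + b)) : (forall i, (i < a)%N -> g i = g' i) ->
  fill_with n g x = fill_with n g' x.
Proof.
elim: a b x => [|a IH] b x gg' //=.
rewrite IH => [|i ia]; last by rewrite gg' // ltnW.
by rewrite gg'.
Qed.

Lemma fill_expand N a b (x : PreLie (a + b)) :
  @fill N a b x = \sum_(G : {ffun 'I_a -> btree N})
    (\prod_i weight (G i)) *: fill_with n (pad_ffun G) x.
Proof.
elim: a b x => [|a IH] b x /=.
  have [G0] : exists G : {ffun 'I_0 -> btree N}, True by exists (ffun0 (card_ord 0)).
  move=> _; rewrite (bigD1 G0) //= big_ord0 scale1r big1 ?addr0 // => G /eqP [].
  by apply/ffunP => -[].
rewrite sum_ffun_rcons (sig_big_dep _ (fun=> xpredT)) /=.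
apply: eq_bigr => S _; rewrite IH scaler_sumr; apply: eq_bigr => G _.
rewrite scalerA big_ord_recr /= [ffun_rcons G S ord_max]ffunE unlift_none mulrC.
have wl (i : 'I_a) : widen_ord (leqnSn a) i = lift ord_max i.
  by apply: val_inj; rewrite /= /bump leqNgt ltn_ord.
congr (_ * _ *: _).
  by apply: eq_bigr => i _; rewrite ffunE wl liftK.
have ga : pad_ffun (ffun_rcons G S) a = btree_val S.
  by rewrite /pad_ffun insubT // => ?; rewrite ffunE (_ : Sub _ _ =
    ord_max) ?unlift_none //; apply: val_inj.
rewrite ga; apply: fill_with_ext => i ia.
rewrite /pad_ffun insubT (insubT (fun i => i < a.+1)%N (ltnW ia)) ffunE.
rewrite (_ : Sub i _ = lift ord_max (Sub i ia : 'I_a)) ?liftK //.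
by apply: val_inj; rewrite /= /bump leqNgt ia.
Qed.

(** The component of arity [n + 1] of the tree [p] with [y] substituted at each
    vertex. *)
Definition tree_subst N (V : finType) (p : V -> option V) : coinv PreLie n.+1 :=
  \sum_(G : {ffun V -> btree N}) (\prod_v weight (G v)) *:
     blowup_sum n.+1 p (fun v => btree_val (G v)).

Lemma fill_with_cast k a b (e : k = (a + b)%N) g (T : tree k) :
  fill_with n g (op_cast (P := PreLie) e (tvec T) : PreLie (a + b)) =
    blowup_sum n.+1 (par T) (fun v => pad a g v).
Proof. by subst k; exact: fill_withE. Qed.

Lemma fill_with_cast_linear g k a b (e : k = (a + b)%N) :
  linear (fun x : PreLie k => fill_with n g (op_cast (P := PreLie) e x : PreLie (a + b))).
Proof. by subst k; exact: fill_with_linear. Qed.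

Lemma fill_tree_subst N a (x : PreLie a) :
  @fill N a 0 (op_cast (esym (addn0 a)) x) =
  \sum_T (x : prelie_space a) T *: tree_subst N (par T).
Proof.
rewrite fill_expand.
transitivity (\sum_(G : {ffun 'I_a -> btree N}) \sum_T (\prod_i weight (G i)) *:
   fill_with n (pad_ffun G) (op_cast (P := PreLie) (esym (addn0 a))
      ((x : prelie_space a) T *: tvec T) : PreLie (a + 0))).
  apply: eq_bigr => G _; rewrite -scaler_sumr [X in op_cast _ X]tvecE.
  by rewrite (linear_big _ (fill_with_cast_linear (pad_ffun G) (esym (addn0 a)))).
rewrite exchange_big; apply: eq_bigr => T _ /=.
rewrite scaler_sumr; apply: eq_bigr => G _.
rewrite [fill_with _ _ _](linear_scale _ _ (fill_with_cast_linear (pad_ffun G)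
  (esym (addn0 a)))) fill_with_cast scalerA mulrC -scalerA.
congr (_ *: (_ *: blowup_sum _ _ _)); apply/functional_extensionality_dep => v.
by rewrite /pad ltn_ord /pad_ffun valK.
Qed.

End Expansion.

Lemma hat_mul_tree_subst (x y : hat PreLie) n N : (n < N)%N ->
  hat_mul x y n =
  \sum_(m < n.+1) \sum_T (of_coinv (x m) : prelie_space m.+1) T *: tree_subst y n N (par T).
Proof.
move=> nN; apply: eq_bigr => m _.
rewrite -[LHS]/(\sum_(k : m.+1.-tuple 'I_n.+1)
  hat_gamma_at y n (fun i => nth ord0 k i) (op_cast (esym (addn0 m.+1)) (of_coinv (x m)))).
by rewrite sum_gamma -(fill_bound _ _ nN) fill_tree_subst.
Qed.


(** * Blow-ups of grafted trees *)

Section BlowsumIso.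
Variables (V V' : finType) (p : V -> option V) (p' : V' -> option V').
Variables (h : V -> V') (h' : V' -> V).
Hypotheses (hK : cancel h h') (h'K : cancel h' h).
Hypothesis hp : forall v, p' (h v) = omap h (p v).

Lemma blowup_sum_iso n (G : V' -> ltree) : blowup_sum n p (fun v => G (h v)) =
  blowup_sum n p' G.
Proof.
rewrite (@blowup_sumE _ _ (fibre_union G) _ _ (fun w => h' (tag w)) (@fibre_par V' G)).
  apply: eq_bigl => P; apply/blowupP/blowupP => bP w; have := bP w; case: (fibre_par w) => //.
    rewrite -[tag w]h'K hp hK => <-; case: (P w) => //= u; by rewrite h'K.
  rewrite -[tag w]h'K hp hK; case: (P w) => [u|]; case: (p _) => //= v [] e.
  by rewrite e hK.
move=> v; have [s [t [sK ps st qs]]] := fibre_std G (h v).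
exists s, t; split=> // [x|w e]; first by rewrite ps hK.
by apply: st; rewrite -e h'K.
Qed.

(** Invariance under relabelling, which makes the substitution well defined on the
    coinvariants. *)
Lemma tree_subst_iso y n N : tree_subst y n N p = tree_subst y n N p'.
Proof.
rewrite /tree_subst (reindex (fun G : {ffun V' -> btree N} => [ffun v => G (h v)])) /=.
  apply: eq_bigr => G _; congr (_ *: _).
    rewrite [RHS](reindex h) /=; first by apply: eq_bigr => v _; rewrite ffunE.
    by exists h' => v _; rewrite ?hK ?h'K.
  rewrite -(@blowup_sum_iso n.+1 (fun v => btree_val (G v))); congr blowup_sum.
  by apply/functional_extensionality_dep => v; rewrite ffunE.
by exists (fun G => [ffun v => G (h' v)]) => G _; apply/ffunP => v; rewrite !ffunE ?hK ?h'K.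
Qed.

End BlowsumIso.

(** Each fibre has at least one vertex. *)
Lemma tree_subst_zero y n N (V : finType) (p : V -> option V)
  : (n.+1 < #|V|)%N -> tree_subst y n N p = 0.
Proof.
move=> nV; rewrite /tree_subst big1 // => G _; rewrite [blowup_sum _ _ _]big1 ?scaler0 //
  => P _.
apply: tree_class_card => e; move: nV; rewrite ltnNge -e => /negP; apply.
pose f v : fibre_union (fun v => btree_val (G v)) := Tagged (fun v => 'I_(tag (btree_val (G
  v)))) (@ord0 (tag (G v))).
by apply: (@leq_card _ _ f) => u v /(congr1 tag).
Qed.

(** The parent function of [graft], on a disjoint union instead of an initial
    segment of the integers. *)
Definition graft_at (V2 V1 : Type) (p2 : V2 -> option V2) (p1 : V1 -> option V1) (s : V1)
  (v : V2 + V1) : option (V2 + V1) :=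
  match v with
  | inl t => if p2 t is Some t' then Some (inl t') else Some (inr s)
  | inr u => omap inr (p1 u)
  end.

Lemma unsplit_graft m n (S : tree n) (T : tree m) s v :
  par (graft S T s) (unsplit v) = omap (@unsplit m n) (graft_at (par T) (par S) s v).
Proof.
rewrite /par /= ffunE unsplitK; case: v => [t|u] /=.
  by rewrite /par; case: (val T t).
by rewrite /par; case: (val S u).
Qed.

Definition summap (A B C D : Type) (f : A -> B) (g : C -> D) (x : A + C) : B + D :=
  match x with inl a => inl (f a) | inr c => inr (g c) end.

Definition sumpar (W2 W1 : Type) (q2 : W2 -> option W2) (q1 : W1 -> option W1)
  (w : W2 + W1) : option (W2 + W1) :=
  match w with inl t => omap inl (q2 t) | inr u => omap inr (q1 u) end.

Section BlowGraft.
Variables (V2 V1 W2 W1 : finType).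
Variables (p2 : V2 -> option V2) (p1 : V1 -> option V1).
Variables (pi2 : W2 -> V2) (pi1 : W1 -> V1).
Variables (q2 : W2 -> option W2) (q1 : W1 -> option W1).
Variable rt : W2.
Hypotheses (q2rt : q2 rt = None) (p2rt : p2 (pi2 rt) = None).
Hypothesis rt_uniq : forall t, q2 t = None -> p2 (pi2 t) = None -> t = rt.
Let pi := summap pi2 pi1.
Let q := sumpar q2 q1.
Let inl_part (o : option (W2 + W1)) := if o is Some (inl t) then Some t else None.
Let inr_part (o : option (W2 + W1)) := if o is Some (inr t) then Some t else None.

(** The root of the fibre over the root of the grafted tree is the only vertex of
    the first summand attached to the second summand, at some [w] over [s]. *)
Lemma blowup_graftE s (P : {ffun W2 + W1 -> option (W2 + W1)}) :
  blowup pi q (graft_at p2 p1 s) P ->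
  exists2 w, inr_part (P (inl rt)) = Some w & pi1 w = s /\
    forall v, P v = graft_at (fun t => inl_part (P (inl t)))
      (fun u => inr_part (P (inr u))) w v.
Proof.
move=> /blowupP b; have := b (inl rt); rewrite /= q2rt /= p2rt.
case ert: (P _) => [[t|w]|] //= [ws]; exists w; rewrite ?ert //; split=> // -[t|u] /=.
  have := b (inl t); rewrite /=; case q2t: (q2 t) => [t'|] /=; first by move->.
  case p2t: (p2 (pi2 t)) => [v'|]; first by case: (P _) => [[]|].
  by rewrite (rt_uniq q2t p2t) ert.
have := b (inr u); rewrite /=; case q1u: (q1 u) => [u'|] /=; first by move->.
by case: (P _) => [[]|] //=; case: (p1 _).
Qed.

(** The condition at the new edge holds by itself, as [w] lies over [pi1 w]. *)
Lemma blowup_graft_iff (P2 : W2 -> option W2) (P1 : W1 -> option W1) w :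
  blowup pi q (graft_at p2 p1 (pi1 w)) (graft_at P2 P1 w) =
    blowup pi1 q1 p1 P1 && blowup pi2 q2 p2 P2.
Proof.
apply/blowupP/andP => [b|[/blowupP b1 /blowupP b2] [t|u] /=].
- split; [apply/blowupP => u|apply/blowupP => t].
    have := b (inr u); rewrite /=; case: (q1 u) => [u'|] /=;
      first by case: (P1 u) => //= u'' [->].
    by case: (P1 u) => [u'|]; case: (p1 _) => //= v [->].
  have := b (inl t); rewrite /=; case: (q2 t) => [t'|] /=;
    first by case: (P2 t) => //= t'' [->].
  by case: (P2 t) => [t'|]; case: (p2 _) => //= v [->].
- have := b2 t; case: (q2 t) => [t'|] /= => [->|] //.
  by move=> <-; case: (P2 t).
have := b1 u; case: (q1 u) => [u'|] /= => [->|] //.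
by move=> <-; case: (P1 u).
Qed.

(** The sum over the vertices [s] of the lower tree and the choice of a vertex over
    [s] together become a free sum over the vertices [w] of its blow-up. *)
Lemma sum_blowup_graft (R : nmodType) (F : {ffun W2 + W1 -> option (W2 + W1)} -> R) :
  \sum_s \sum_(P | blowup pi q (graft_at p2 p1 s) (P : {ffun W2 + W1 -> option (W2 + W1)}))
    F P =
  \sum_(P1 : {ffun W1 -> option W1} | blowup pi1 q1 p1 P1)
   \sum_(P2 : {ffun W2 -> option W2} | blowup pi2 q2 p2 P2)
     \sum_w F [ffun v => graft_at P2 P1 w v].
Proof.
rewrite pair_big_dep /=; under [RHS]eq_bigr => P1 _ do rewrite pair_big_dep /=.
rewrite pair_big_dep /=.
pose I := (V1 * {ffun W2 + W1 -> option (W2 + W1)})%type.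
pose J := ({ffun W1 -> option W1} * ({ffun W2 -> option W2} * W1))%type.
pose h (j : J) : I := (pi1 j.2.2, [ffun v => graft_at j.2.1 j.1 j.2.2 v]).
(* [w] is the parent, in the second summand, of the root [rt] *)
pose h' (i : I) : option J := omap (fun w => ([ffun u => inr_part (i.2 (inr u))],
   ([ffun t => inl_part (i.2 (inl t))], w))) (inr_part (i.2 (inl rt))).
rewrite (reindex_omap h h') /=.
  apply: eq_bigl => -[P1 [P2 w]] /=.
  rewrite [blowup _ _ _ _](_ : _ = blowup pi q (graft_at p2 p1 (pi1 w))
    (graft_at P2 P1 w)); last first.
    by apply: eq_forallb => v; rewrite ffunE.
  rewrite blowup_graft_iff andbT.
  apply: andb_idr => /andP [_ /blowupP b2].
  have P2rt : P2 rt = None.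
    by have := b2 rt; rewrite q2rt p2rt; case: (P2 rt).
  rewrite /h' /= ffunE /= P2rt /=; apply/eqP; congr (Some (_, (_, _))); apply/ffunP => v;
    rewrite !ffunE /=.
    by case: (P1 v).
  by case: (P2 v).
move=> [s P] /blowup_graftE [w e [ws eP]]; rewrite /h' /= e /= /h /=; congr (Some (_, _)) => //.
by apply/ffunP => v; rewrite ffunE [RHS]eP; case: v => [t|u] /=; rewrite ffunE.
Qed.

End BlowGraft.

Definition graft_class n (V2 V1 : finType) (p2 : V2 -> option V2) (p1 : V1 -> option V1) :
  coinv PreLie n.+1 := \sum_s tree_class n.+1 (graft_at p2 p1 s).

Lemma fibre_sum (V2 V1 W2 W1 : finType) (pi2 : W2 -> V2) (pi1 : W1 -> V1) q2 q1
    (G : V2 + V1 -> ltree) :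
  (forall v, has_fibre pi2 q2 v (G (inl v))) -> (forall v, has_fibre pi1 q1 v (G (inr v))) ->
  forall v, has_fibre (summap pi2 pi1) (sumpar q2 q1) v (G v).
Proof.
move=> h2 h1 [v|v].
  have [s [t [sK ps st qs]]] := h2 v.
  have [r _ _] := is_treeP _ (valP (tagged (G (inl v)))).
  exists (inl \o s), (fun w => if w is inl w then t w else r); split=> //.
  - by move=> x /=; rewrite ps.
  - by case=> //= w [] /st ->.
  by move=> x /=; rewrite qs; case: (par _ _).
have [s [t [sK ps st qs]]] := h1 v.
have [r _ _] := is_treeP _ (valP (tagged (G (inr v)))).
exists (inr \o s), (fun w => if w is inr w then t w else r); split=> //.
- by move=> x /=; rewrite ps.
- by case=> //= w [] /st ->.
by move=> x /=; rewrite qs; case: (par _ _).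
Qed.

(** [sum_blowup_graft] for each family of trees substituted at the vertices of [S]
    and of [T]; the weights multiply. *)
Lemma tree_subst_graft y n N i j (S : tree i) (T : tree j) :
  \sum_s tree_subst y n N (par (graft S T s)) =
  \sum_(G1 : {ffun 'I_i -> btree N}) \sum_(G2 : {ffun 'I_j -> btree N})
   ((\prod_v weight y (G1 v)) * (\prod_v weight y (G2 v))) *:
   \sum_(P1 : {ffun fibre_union (fun v => btree_val (G1 v)) -> _} |
      blowup tag (@fibre_par _ (fun v => btree_val (G1 v))) (par S) P1)
   \sum_(P2 : {ffun fibre_union (fun v => btree_val (G2 v)) -> _} |
      blowup tag (@fibre_par _ (fun v => btree_val (G2 v))) (par T) P2)
     graft_class n P2 P1.
Proof.
transitivity (\sum_s tree_subst y n N (graft_at (par T) (par S) s)).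
  apply: eq_bigr => s _; symmetry.
  exact: (tree_subst_iso (@unsplitK j i) (@splitK j i) (unsplit_graft S T s)).
under eq_bigr => s _ do rewrite /tree_subst sum_ffun_sum.
rewrite exchange_big /=; apply: eq_bigr => G1 _.
rewrite exchange_big /=; apply: eq_bigr => G2 _.
rewrite -scaler_sumr big_sumType /= mulrC; congr (_ * _ *: _).
- by apply: eq_bigr => v _; rewrite ffunE.
- by apply: eq_bigr => v _; rewrite ffunE.
have hW v : has_fibre (summap tag tag) (sumpar (@fibre_par _ (fun v => btree_val (G2 v)))
     (@fibre_par _ (fun v => btree_val (G1 v)))) v (btree_val (ffun_sum G2 G1 v)).
  move: v; apply: (fibre_sum (G := fun v => btree_val (ffun_sum G2 G1 v))) => v; rewrite ffunE.
    exact: (@fibre_std _ (fun v => btree_val (G2 v))).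
  exact: (@fibre_std _ (fun v => btree_val (G1 v))).
under eq_bigr => s _ do rewrite (blowup_sumE _ _ hW).
have [r [pr rr]] := tree_root_uniq T.
have [rt [pirt qrt rtu]] := fibre_root (@fibre_std _ (fun v => btree_val (G2 v)) r).
rewrite (@sum_blowup_graft _ _ _ _ _ _ _ _ _ _ rt) //; last first.
- by move=> t qt pt; apply: rtu => //; exact: rr.
- by rewrite pirt.
apply: eq_bigr => P1 _; apply: eq_bigr => P2 _; apply: eq_bigr => w _.
by apply: eq_tree_class => v; rewrite ffunE.
Qed.

Lemma graft_class_iso n (V2 V1 V2' V1' : finType) (p2 : V2 -> option V2) (p1 : V1 -> option V1)
  (p2' : V2' -> option V2') (p1' : V1' -> option V1') h2 h2' h1 h1' :
  cancel h2 h2' -> cancel h2' h2 -> (forall v, p2' (h2 v) = omap h2 (p2 v)) ->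
  cancel h1 h1' -> cancel h1' h1 -> (forall v, p1' (h1 v) = omap h1 (p1 v)) ->
  graft_class n p2 p1 = graft_class n p2' p1'.
Proof.
move=> h2K h2'K e2 h1K h1'K e1.
rewrite /graft_class [RHS](reindex h1); last by exists h1' => v _; rewrite ?h1K ?h1'K.
apply: eq_bigr => s _; apply: (@tree_class_iso _ _ _ _ _ (summap h2 h1)
  (summap h2' h1')) => [[v|v]|[v|v]|[v|v]] /=.
- by rewrite h2K.
- by rewrite h1K.
- by rewrite h2'K.
- by rewrite h1'K.
- by rewrite e2; case: (p2 v).
- by rewrite e1; case: (p1 v).
Qed.


(** * The pre-Lie product on the coinvariants *)

Lemma hat_of_graft n i j (x : PreLie i) (y : PreLie j) :
  hat_of (prelie_graft x y) n =
  \sum_S \sum_T ((x : prelie_space i) S * (y : prelie_space j) T) *: graft_class n (par T)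
    (par S).
Proof.
rewrite /prelie_graft (linear_big _ (@hat_of_linear PreLie _ n)); apply: eq_bigr => S _.
rewrite (linear_big _ (@hat_of_linear PreLie _ n)); apply: eq_bigr => T _.
rewrite (linear_scale _ _ (@hat_of_linear PreLie _ n)); congr (_ *: _).
rewrite (linear_big _ (@hat_of_linear PreLie _ n)); apply: eq_bigr => s _.
rewrite -tree_class_hat_of; symmetry.
exact: (tree_class_iso _ (@unsplitK j i) (@splitK j i) (unsplit_graft S T s)).
Qed.

Lemma relabel_par n (s : 'S_n) (T : tree n) v : par (relabel s T) (s v) = omap s (par T v).
Proof. by rewrite /par /= ffunE permK. Qed.

Section GraftBilinear.
Variables (n i j : nat).

(** The component of arity [n + 1] of the product of two homogeneous elements.  The
    arity is a parameter so that sums over it need no casts. *)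
Definition coinv_graft (u : coinv PreLie i) (w : coinv PreLie j) : coinv PreLie n.+1 :=
  hat_of (prelie_graft (of_coinv u) (of_coinv w)) n.

Lemma graft_linearl y : linear (fun x : PreLie i => hat_of (prelie_graft x (y : PreLie j)) n).
Proof.
move=> c x x'; rewrite !hat_of_graft scaler_sumr -big_split; apply: eq_bigr => S _.
rewrite scaler_sumr -big_split; apply: eq_bigr => T _ /=.
by rewrite scalerA -scalerDl !ffunE mulrDl mulrA.
Qed.

Lemma graft_linearr x : linear (fun y : PreLie j => hat_of (prelie_graft (x : PreLie i) y) n).
Proof.
move=> c y y'; rewrite !hat_of_graft scaler_sumr -big_split; apply: eq_bigr => S _.
rewrite scaler_sumr -big_split; apply: eq_bigr => T _ /=.
by rewrite scalerA -scalerDl !ffunE mulrDr mulrCA.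
Qed.

Lemma coinv_graft_coinv x y : coinv_graft (to_coinv x)
  (to_coinv y) = hat_of (prelie_graft x y) n.
Proof.
rewrite /coinv_graft (@coinv_lift PreLie _ _ (fun x => hat_of (prelie_graft x _) n)).
- apply: (@coinv_lift PreLie _ _ (fun y => hat_of (prelie_graft x y) n));
  first exact: graft_linearr.
  move=> s z; rewrite !hat_of_graft; apply: eq_bigr => S _.
  rewrite (reindex_inj (can_inj (relabelK s))) /=; apply: eq_bigr => T _.
  rewrite prelie_actE relabelK; congr (_ *: _); symmetry.
  apply: (@graft_class_iso _ _ _ _ _ _ _ _ _ s (s^-1%g) id id) => //.
  + exact: permK.
  + exact: permKV.
  + exact: relabel_par.
  by move=> v; case: (par S v).
- exact: graft_linearl.
move=> s z; rewrite !hat_of_graft.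
rewrite (reindex_inj (can_inj (relabelK s))) /=; apply: eq_bigr => S _.
apply: eq_bigr => T _.
rewrite prelie_actE relabelK; congr (_ *: _); symmetry.
apply: (@graft_class_iso _ _ _ _ _ _ _ _ _ id id s (s^-1%g)) => //.
+ by move=> v; case: (par T v).
+ exact: permK.
+ exact: permKV.
exact: relabel_par.
Qed.

Lemma coinv_graft_linearl w : linear (coinv_graft^~ w).
Proof.
move=> c; elim/lquot_ind => x; elim/lquot_ind => x'; elim/lquot_ind: w => y.
rewrite -linearP /= !coinv_graft_coinv; exact: graft_linearl.
Qed.

Lemma coinv_graft_linearr u : linear (coinv_graft u).
Proof.
move=> c; elim/lquot_ind => x; elim/lquot_ind => x'; elim/lquot_ind: u => y.
rewrite -linearP /= !coinv_graft_coinv; exact: graft_linearr.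
Qed.

End GraftBilinear.


(** * Substitution is a morphism of pre-Lie algebras *)

Definition treelike (V : finType) (p : V -> option V) : Prop :=
  exists2 r, p r = None & forall v, connect [rel u w | p u == Some w] v r.

Lemma treelike_par n (T : tree n) : treelike (par T).
Proof. by have [r pr h] := is_treeP _ (valP T); exists r. Qed.

(** From any vertex one reaches the root of its fibre, then a vertex of the fibre
    over the parent, and so on along the path to the root of [p]. *)
Lemma blowup_treelike (V W : finType) (p : V -> option V) (pi : W -> V) q G
    (P : W -> option W) :
  treelike p -> (forall v, has_fibre pi q v (G v)) -> blowup pi q p P -> treelike P.
Proof.
move=> [r pr cr] hW /blowupP b.
have hv v : exists u, [/\ pi u = v, q u = None & forall w, pi w = v ->
    connect [rel u w | P u == Some w] w u].
  have [s [t [sK ps st qs]]] := hW v; have [rS prS crS] := treelike_par (tagged (G v)).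
  exists (s rS); split=> [||w /st <-]; [exact: ps|by rewrite qs prS|].
  apply: (connect_homo (h := s)) (crS _) => x y /= /eqP xy.
  by apply: connect1; have := b (s x); rewrite /= qs xy /= => ->.
have [rt [prt qrt crt]] := hv r.
have Prt : P rt = None by have := b rt; rewrite qrt prt pr; case: (P rt).
exists rt => // w; have /connectP [s] := cr (pi w).
elim: s w {-2}(pi w) (erefl (pi w)) => [|v' s IH] w v wv /=.
  by move=> _ e; apply: crt; rewrite e.
move=> /andP [/eqP pvv' ps] er.
have [u [pu qu cu]] := hv v; apply: (connect_trans (y := u)); first exact: cu.
have := b u; rewrite qu pu pvv'; case eP: (P u) => [w'|] //= [pw'].
apply: (connect_trans (y := w')); first by apply: connect1; rewrite /= eP.
exact: IH ps er.
Qed.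

Lemma treelike_tree n (V : finType) (p : V -> option V) : treelike p -> #|V| = n ->
  exists (T : tree n) h h', [/\ cancel h h', cancel h' h &
    forall v, par T (h v) = omap h (p v)].
Proof.
move=> [r pr cr] cV.
pose h v : 'I_n := cast_ord cV (enum_rank v); pose h' i : V := enum_val (cast_ord (esym cV) i).
have hK : cancel h h' by move=> v; rewrite /h /h' cast_ordK enum_rankK.
have h'K : cancel h' h by move=> v; rewrite /h /h' enum_valK cast_ordKV.
pose q : parent_fun n := [ffun i => omap h (p (h' i))].
have tq : is_tree q.
  apply/is_treeP; exists (h r); first by rewrite ffunE hK pr.
  move=> i; rewrite -(h'K i); apply: (connect_homo (h := h)) (cr _) => x y /= /eqP xy.
  by apply: connect1; rewrite /= ffunE hK xy.
exists (exist _ q tq), h, h'; split=> // v.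
by rewrite /par /= ffunE hK.
Qed.

Lemma coinv_graft_tree_class n i j (V2 V1 : finType) (p2 : V2 -> option V2)
  (p1 : V1 -> option V1) :
  treelike p2 -> treelike p1 -> #|V1| = i -> #|V2| = j ->
  coinv_graft n (tree_class i p1) (tree_class j p2) = graft_class n p2 p1.
Proof.
move=> t2 t1 c1 c2.
have [S [h1 [h1' [h1K h1'K hS]]]] := treelike_tree t1 c1.
have [T [h2 [h2' [h2K h2'K hT]]]] := treelike_tree t2 c2.
rewrite (tree_class_iso i h1K h1'K hS) (tree_class_iso j h2K h2'K hT)
  !tree_class_tree coinv_graft_coinv hat_of_graft.
rewrite (graft_class_iso n h2K h2'K hT h1K h1'K hS).
rewrite (bigD1 S) //= [X in _ + X]big1 ?addr0; last first.
  move=> S' nS; rewrite big1 // => T' _; rewrite ffunE (negPf nS) mul0r scale0r //.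
rewrite (bigD1 T) //= big1 ?addr0; last first.
  by move=> T' nT; rewrite !ffunE (negPf nT) mulr0 scale0r.
by rewrite !ffunE !eqxx mulr1 scale1r.
Qed.

Lemma coinv_graft0l n i j (w : coinv PreLie j) : coinv_graft n (0 : coinv PreLie i) w = 0.
Proof. exact: (linear_zero (@coinv_graft_linearl n i j w)). Qed.

Lemma coinv_graft0r n i j (u : coinv PreLie i) : coinv_graft n u (0 : coinv PreLie j) = 0.
Proof. exact: (linear_zero (@coinv_graft_linearr n i j u)). Qed.

Lemma graft_class_card n (V2 V1 : finType) (p2 : V2 -> option V2) (p1 : V1 -> option V1) :
  (#|V2| + #|V1| <> n.+1)%N -> graft_class n p2 p1 = 0.
Proof.
by move=> ne; rewrite /graft_class big1 // => s _; apply: tree_class_card; rewrite card_sum.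
Qed.

(** Only the arities [#|V1|] and [#|V2|] contribute, and only if they add up to
    [n + 1]; otherwise both sides vanish. *)
Lemma sum_coinv_graft_tree_class n (V2 V1 : finType) (p2 : V2 -> option V2)
  (p1 : V1 -> option V1) :
  treelike p2 -> treelike p1 ->
  \sum_(i < n.+1) \sum_(j < n.+1) coinv_graft n (tree_class i.+1 p1)
    (tree_class j.+1 p2) = graft_class n p2 p1.
Proof.
move=> t2 t1.
have [r2 _ _] := t2; have [r1 _ _] := t1.
have c2 : #|V2| = #|V2|.-1.+1 by rewrite prednK //; apply/card_gt0P; exists r2.
have c1 : #|V1| = #|V1|.-1.+1 by rewrite prednK //; apply/card_gt0P; exists r1.
have z i j : (#|V2| + #|V1| <> n.+1)%N \/ #|V1| <> i \/ #|V2| <> j ->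
    coinv_graft n (tree_class i p1) (tree_class j p2) = 0.
  have [e1|/eqP n1] := eqVneq #|V1| i; last by rewrite (tree_class_card _ n1) coinv_graft0l.
  have [e2|/eqP n2] := eqVneq #|V2| j; last by rewrite (tree_class_card _ n2) coinv_graft0r.
  rewrite (coinv_graft_tree_class _ t2 t1 e1 e2) => -[/graft_class_card ->|[]] //.
have [e|/eqP ne] := eqVneq (#|V2| + #|V1|)%N n.+1; last first.
  by rewrite graft_class_card // big1 // => i _; rewrite big1 // => j _; rewrite z //; left.
have i1 : (#|V1|.-1 < n.+1)%N by rewrite -c1 -e leq_addl.
have i2 : (#|V2|.-1 < n.+1)%N by rewrite -c2 -e leq_addr.
rewrite (bigD1 (Ordinal i1)) //= [X in _ + X]big1 ?addr0; last first.
  move=> i; rewrite -val_eqE /= => ni; rewrite big1 // => j _; rewrite z //; right; left.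
  by move=> ei; rewrite ei eqxx in ni.
rewrite (bigD1 (Ordinal i2)) //= [X in _ + X]big1 ?addr0; last first.
  move=> j; rewrite -val_eqE /= => nj; rewrite z //; right; right.
  by move=> ej; rewrite ej eqxx in nj.
exact: coinv_graft_tree_class.
Qed.

Section Morphism.
Variables (y : hat PreLie).

(** The substitution of [y] in [x], in arity [n + 1].  It is defined on
    representatives, and invariant by [subst_act]. *)
Definition subst_comp N n k (x : PreLie k) : coinv PreLie n.+1 :=
  \sum_T (x : prelie_space k) T *: tree_subst y n N (par T).

Lemma subst_linear N n k : linear (@subst_comp N n k).
Proof.
move=> c x x'; rewrite /subst_comp scaler_sumr -big_split; apply: eq_bigr => T _ /=.
by rewrite scalerA -scalerDl !ffunE.
Qed.

Lemma subst_act N n k (s : 'S_k) (x : PreLie k) :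
  subst_comp N n (op_act PreLie s x) = subst_comp N n x.
Proof.
rewrite /subst_comp (reindex_inj (can_inj (relabelK s))) /=; apply: eq_bigr => T _.
rewrite prelie_actE relabelK; congr (_ *: _); symmetry.
apply: (tree_subst_iso (permK s) (permKV s)); exact: relabel_par.
Qed.

Lemma subst_coinv N n k (x : PreLie k) :
  subst_comp N n (of_coinv (to_coinv x)) = subst_comp N n x.
Proof.
exact: (coinv_lift (@subst_linear N n k) (@subst_act N n k)).
Qed.

Lemma subst_zero N n k (x : PreLie k) : (n.+1 < k)%N -> subst_comp N n x = 0.
Proof.
by move=> nk; rewrite /subst_comp big1 // => T _; rewrite tree_subst_zero ?scaler0 // card_ord.
Qed.

Lemma hat_mulE x n N M : (n < N)%N -> (n < M)%N ->
  hat_mul x y n = \sum_(m < M) subst_comp N n (of_coinv (x m)).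
Proof.
move=> nN nM; rewrite (hat_mul_tree_subst _ _ nN).
rewrite (sum_ord_zero (f := fun m => subst_comp N n (of_coinv (x m))) nM) // => k nk.
exact: subst_zero.
Qed.

(** The arity of [hat_of x] is the one of [x]; if it exceeds [n + 1] then both sides
    vanish by [subst_zero]. *)
Lemma sum_subst_hat_of N n k (x : PreLie k.+1) :
  \sum_(m < n.+1) subst_comp N n (of_coinv (hat_of x m)) = subst_comp N n x.
Proof.
have h m : subst_comp N n (of_coinv (hat_of x m)) = if k == m then subst_comp N n x else 0.
  rewrite /hat_of; case: eqP => [e|ne]; last first.
    case: eqP => [e|_]; first by case: ne; rewrite e.
    by rewrite (subst_coinv N n (0 : PreLie m.+1)) (linear_zero (@subst_linear N n _)).
  rewrite subst_coinv; have em : m = k by case: e.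
  by subst m; rewrite eqxx (eq_irrelevance e (erefl _)).
under eq_bigr => m _ do rewrite h.
have [kn|nk] := ltnP k n.+1; last first.
  by rewrite subst_zero // big1 // => m _; case: eqP.
rewrite (bigD1 (Ordinal kn)) //= eqxx big1 ?addr0 // => m.
by rewrite -val_eqE /= eq_sym => /negPf ->.
Qed.

End Morphism.

(** The pre-Lie product of the completion. *)
Definition hat_graft (x z : hat PreLie) : hat PreLie := fun n =>
  \sum_(i < n.+1) \sum_(j < n.+1) coinv_graft n (x i) (z j).

Lemma coinv_graft_lt n i j (u : coinv PreLie i.+1) (w : coinv PreLie j.+1) :
  (n <= i)%N \/ (n <= j)%N -> coinv_graft n u w = 0.
Proof.
move=> h; rewrite /coinv_graft /hat_of; case: eqP => // e; exfalso.
have {}e : (j + i.+1)%N = n by case: e.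
case: h; rewrite -e leqNgt => /negP; apply; first by rewrite addnS ltnS leq_addl.
by rewrite addnS ltnS leq_addr.
Qed.

Lemma hat_graft_bound x z n M : (n < M)%N ->
  hat_graft x z n = \sum_(i < M) \sum_(j < M) coinv_graft n (x i) (z j).
Proof.
move=> nM; rewrite /hat_graft.
rewrite (sum_ord_zero (f := fun i => \sum_(j < M) coinv_graft n (x i) (z j)) nM); last first.
  by move=> k nk; rewrite big1 // => j _; rewrite coinv_graft_lt //; left; apply: ltnW.
apply: eq_bigr => i _; rewrite (sum_ord_zero (f := fun j => coinv_graft n (x i) (z j)) nM) //.
by move=> k nk; rewrite coinv_graft_lt //; right; apply: ltnW.
Qed.

Lemma coinv_graft_suml n i j (I : finType) (F : I -> coinv PreLie i) (w : coinv PreLie j) :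
  coinv_graft n (\sum_k F k) w = \sum_k coinv_graft n (F k) w.
Proof. exact: (linear_big F (@coinv_graft_linearl n i j w)). Qed.

Lemma coinv_graft_sumr n i j (I : finType) (F : I -> coinv PreLie j) (u : coinv PreLie i) :
  coinv_graft n u (\sum_k F k) = \sum_k coinv_graft n u (F k).
Proof. exact: (linear_big F (@coinv_graft_linearr n i j u)). Qed.

Lemma coinv_graftZl n i j c (u : coinv PreLie i) (w : coinv PreLie j) :
  coinv_graft n (c *: u) w = c *: coinv_graft n u w.
Proof. exact: (linear_scale c u (@coinv_graft_linearl n i j w)). Qed.

Lemma coinv_graftZr n i j c (u : coinv PreLie i) (w : coinv PreLie j) :
  coinv_graft n u (c *: w) = c *: coinv_graft n u w.
Proof. exact: (linear_scale c w (@coinv_graft_linearr n i j u)). Qed.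

(** The case of two trees of the morphism property. *)
Lemma coinv_graft_tree_subst y n N k l (S : tree k) (T : tree l) :
  \sum_(i < n.+1) \sum_(j < n.+1) coinv_graft n (tree_subst y i N (par S))
    (tree_subst y j N (par T)) =
  \sum_s tree_subst y n N (par (graft S T s)).
Proof.
rewrite tree_subst_graft.
pose W (V : finType) (G : {ffun V -> btree N}) := fibre_union (fun v => btree_val (G v)).
pose Q (V : finType) (G : {ffun V -> btree N}) := @fibre_par _ (fun v => btree_val (G v)).
transitivity (\sum_(i < n.+1) \sum_(j < n.+1)
  \sum_(G1 : {ffun 'I_k -> btree N}) \sum_(G2 : {ffun 'I_l -> btree N})
   ((\prod_v weight y (G1 v)) * (\prod_v weight y (G2 v))) *:
   \sum_(P1 : {ffun W _ G1 -> option (W _ G1)}| blowup tag (Q _ G1) (par S) P1)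
   \sum_(P2 : {ffun W _ G2 -> option (W _ G2)} | blowup tag (Q _ G2) (par T) P2)
     coinv_graft n (tree_class i.+1 P1) (tree_class j.+1 P2)).
  apply: eq_bigr => i _; apply: eq_bigr => j _.
  rewrite /tree_subst coinv_graft_suml; apply: eq_bigr => G1 _.
  rewrite coinv_graft_sumr; apply: eq_bigr => G2 _.
  rewrite coinv_graftZl coinv_graftZr scalerA; congr (_ *: _).
  rewrite /blowup_sum big_mkcond coinv_graft_suml [RHS]big_mkcond; apply: eq_bigr => P1 _.
  case: ifP => _; last exact: coinv_graft0l.
  rewrite big_mkcond coinv_graft_sumr [RHS]big_mkcond; apply: eq_bigr => P2 _.
  by case: ifP => _; last exact: coinv_graft0r.
rewrite exchange_big22; apply: eq_bigr => G1 _; apply: eq_bigr => G2 _.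
rewrite scaler_sum2 exchange_big22; congr (_ *: _).
apply: eq_bigr => P1 b1; apply: eq_bigr => P2 b2.
apply: sum_coinv_graft_tree_class; apply: blowup_treelike (treelike_par _) _ _;
  [|exact: b2| |exact: b1].
  exact: (@fibre_std _ (fun v => btree_val (G2 v))).
exact: (@fibre_std _ (fun v => btree_val (G1 v))).
Qed.

(** Both sides are bilinear in [x] and [z], and for two trees the identity is
    [coinv_graft_tree_subst]; the rest is an interchange of finite sums. *)
Lemma hat_mul_hat_graft x z y : hat_mul (hat_graft x z) y = hat_graft (hat_mul x y)
  (hat_mul z y).
Proof.
apply/functional_extensionality_dep => n.
transitivity (\sum_(k < n.+1) \sum_(l < n.+1)
   subst_comp y n.+1 n (prelie_graft (of_coinv (x k)) (of_coinv (z l)))).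
  rewrite (@hat_mulE y _ n n.+1 n.+1) //.
  transitivity (\sum_(m < n.+1) \sum_(k < n.+1) \sum_(l < n.+1)
      subst_comp y n.+1 n (of_coinv (coinv_graft m (x k) (z l)))).
    apply: eq_bigr => m _; rewrite (@hat_graft_bound _ _ _ n.+1) //.
    pose f q := subst_comp y n.+1 n (of_coinv (q : coinv PreLie m.+1)).
    have fl : linear f.
      move=> c; elim/lquot_ind => u; elim/lquot_ind => v.
      by rewrite -linearP /= /f !subst_coinv subst_linear.
    rewrite -/(f _) (linear_big _ fl); apply: eq_bigr => k _.
    by rewrite (linear_big _ fl).
  rewrite exchange_big; apply: eq_bigr => k _.
  rewrite exchange_big; apply: eq_bigr => l _ /=.
  exact: sum_subst_hat_of.
pose xs k := of_coinv (x k) : prelie_space k.+1.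
pose zs k := of_coinv (z k) : prelie_space k.+1.
transitivity (\sum_(k < n.+1) \sum_(l < n.+1) \sum_S \sum_T (xs k S * zs l T) *:
   \sum_s tree_subst y n n.+1 (par (graft S T s))).
  apply: eq_bigr => k _; apply: eq_bigr => l _; rewrite /prelie_graft.
  rewrite (linear_big _ (@subst_linear _ _ _ _)); apply: eq_bigr => S _.
  rewrite (linear_big _ (@subst_linear _ _ _ _)); apply: eq_bigr => T _.
  rewrite (linear_scale _ _ (@subst_linear _ _ _ _)); congr (_ *: _).
  rewrite (linear_big _ (@subst_linear _ _ _ _)); apply: eq_bigr => s _.
  rewrite /subst_comp (bigD1 (graft S T s)) //= ffunE eqxx scale1r big1 ?addr0 // => R
    /negPf nR.
  by rewrite ffunE nR scale0r.
rewrite /hat_graft.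
transitivity (\sum_(i < n.+1) \sum_(j < n.+1) \sum_(k < n.+1) \sum_(l < n.+1) \sum_S \sum_T
   (xs k S * zs l T) *: coinv_graft n (tree_subst y i n.+1 (par S))
     (tree_subst y j n.+1 (par T))).
  rewrite [RHS]exchange_big22; apply: eq_bigr => k _; apply: eq_bigr => l _.
  rewrite [RHS]exchange_big22; apply: eq_bigr => S _; apply: eq_bigr => T _.
  by rewrite scaler_sum2 coinv_graft_tree_subst.
apply: eq_bigr => i _; apply: eq_bigr => j _.
rewrite (@hat_mulE y x i n.+1 n.+1) ?ltn_ord // (@hat_mulE y z j n.+1 n.+1) ?ltn_ord //.
rewrite coinv_graft_suml; apply: eq_bigr => k _.
rewrite coinv_graft_sumr; apply: eq_bigr => l _.
rewrite /subst_comp coinv_graft_suml; apply: eq_bigr => S _.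
rewrite coinv_graft_sumr; apply: eq_bigr => T _.
by rewrite coinv_graftZl coinv_graftZr scalerA.
Qed.


(** * The exponential map of the completed pre-Lie algebra *)

Fixpoint graft_pow (x : hat PreLie) (k : nat) : hat PreLie :=
  if k is k'.+1 then hat_graft (graft_pow x k') x else x.

Definition hat_exp_coef (k : nat) : rat := (k.+1`!%:R)^-1.

(** The power with [k + 1] factors starts in arity [k + 1] ([graft_pow_zero]), so the
    sum is finite in each arity. *)
Definition hat_exp (x : hat PreLie) : hat PreLie := fun n =>
  \sum_(k < n.+1) hat_exp_coef k *: graft_pow x k n.

Lemma graft_pow_zero x k n : (n < k)%N -> graft_pow x k n = 0.
Proof.
elim: k n => [//|k IH] n nk /=; rewrite /hat_graft big1 // => i _; rewrite big1 // => j _.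
have [ik|ki] := ltnP i k; first by rewrite IH // coinv_graft0l.
by rewrite coinv_graft_lt //; left; apply: leq_trans ki.
Qed.

Lemma hat_mul_graft_pow x y k : hat_mul (graft_pow x k) y = graft_pow (hat_mul x y) k.
Proof. by elim: k => //= k IH; rewrite hat_mul_hat_graft IH. Qed.

Lemma subst_lift_linear y N n k :
  linear (fun u : coinv PreLie k => subst_comp y N n (of_coinv u)).
Proof. exact: (coinv_lift_linear (@subst_linear y N n k) (@subst_act y N n k)). Qed.

Lemma hat_mul_hat_exp x y : hat_mul (hat_exp x) y = hat_exp (hat_mul x y).
Proof.
apply/functional_extensionality_dep => n; rewrite (@hat_mulE y _ n n.+1 n.+1) //.
transitivity (\sum_(m < n.+1) \sum_(k < n.+1) hat_exp_coef k *: subst_comp y n.+1 n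
  (of_coinv (graft_pow x k m))).
  apply: eq_bigr => m _; rewrite (linear_big _ (@subst_lift_linear y n.+1 n m.+1)).
  rewrite (sum_ord_zero (f := fun k => hat_exp_coef k *: subst_comp y n.+1 n (of_coinv
    (graft_pow x k m))) (ltn_ord m)).
    by apply: eq_bigr => k _; rewrite (linear_scale _ _ (@subst_lift_linear y n.+1 n m.+1)).
  by move=> k mk; rewrite graft_pow_zero // (linear_zero (@subst_lift_linear y n.+1 n
    m.+1)) scaler0.
rewrite exchange_big; apply: eq_bigr => k _ /=.
by rewrite -scaler_sumr -hat_mul_graft_pow (@hat_mulE y _ n n.+1 n.+1).
Qed.

(** A blow-up of the tree with one vertex is the tree substituted at this vertex. *)
Lemma hat_mul_one y : hat_mul (hat_one PreLie) y = y.
Proof.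
apply/functional_extensionality_dep => n; rewrite (@hat_mulE y _ n n.+1 n.+1) //.
rewrite sum_subst_hat_of /subst_comp (bigD1 one_vertex) //= ffunE eqxx scale1r big1 ?addr0;
  last first.
  by move=> T /negPf nT; rewrite ffunE nT scale0r.
pose g (c : btree n.+1) : {ffun 'I_1 -> btree n.+1} := [ffun=> c].
rewrite /tree_subst (reindex g); last first.
  exists (fun G : {ffun 'I_1 -> btree n.+1} => G ord0) => [c _|G _]; first by rewrite ffunE.
  by apply/ffunP => i; rewrite ffunE (ord1 i).
transitivity (\sum_(c < n.+1) \sum_(S : tree c.+1)
    (of_coinv (y c) : prelie_space c.+1) S *: hat_of (tvec S : PreLie c.+1) n).
  rewrite (sig_big_dep _ (fun=> xpredT)) /=; apply: eq_bigr => S _.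
  rewrite big_ord1 ffunE; congr (_ *: _); rewrite -tree_class_hat_of.
  rewrite (@blowup_sumE _ _ 'I_((tag S).+1) _ _ (fun=> ord0) (par (tagged S))).
    rewrite (bigD1 (par (tagged S))) /=; last first.
      by apply/blowupP => w; case e: (par _ w) => //=; rewrite ffunE eqxx.
    rewrite big1 ?addr0 // => P /andP [/blowupP bP /eqP []].
    apply/ffunP => w; have := bP w; case: (par _ w) => [w'|] //.
    by rewrite /= ffunE eqxx; case: (P w).
  move=> v; rewrite ffunE; exists id, id; split=> // [x|x]; first by rewrite (ord1 v).
  by rewrite /=; case: (par _ _).
transitivity (\sum_(c < n.+1) hat_of (of_coinv (y c)) n).
  apply: eq_bigr => c _; rewrite [of_coinv _ in RHS]tvecE.
  rewrite (linear_big _ (@hat_of_linear PreLie _ n)); apply: eq_bigr => S _.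
  by rewrite (linear_scale _ _ (@hat_of_linear PreLie _ n)).
rewrite (bigD1 ord_max) //= hat_of_self big1 ?addr0 // => c cn.
by rewrite hat_of_neq // => e; case/eqP: cn; apply: val_inj.
Qed.

Lemma hat_one0 : hat_one PreLie 0 = gen_v.
Proof.
by rewrite /hat_one /hat_of; case: eqP => // e; rewrite (eq_irrelevance e (erefl _)).
Qed.

Lemma hat_oneS n : hat_one PreLie n.+1 = 0.
Proof. by rewrite /hat_one /hat_of; case: eqP. Qed.

Lemma graft_pow_one k n : graft_pow (hat_one PreLie) k n = hat_of (of_coinv (vpow k)) n.
Proof.
elim: k n => [|k IH] n; first by rewrite hat_of_coinv.
rewrite [RHS](@hat_of_coinv PreLie (1 + k.+1)) /= /hat_graft.
under eq_bigr => i _.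
  rewrite big_ord_recl [X in _ + X]big1 ?addr0 => [|j _];
    last by rewrite hat_oneS coinv_graft0r.
  rewrite /= hat_one0 IH; over.
have [kn|nk] := ltnP k n.+1.
  rewrite (bigD1 (Ordinal kn)) //= big1 ?addr0 => [|i ik].
    by rewrite hat_of_self.
  rewrite hat_of_neq ?coinv_graft0l // => e; case/eqP: ik; exact: val_inj.
rewrite big1 => [|i _]; last first.
  by rewrite hat_of_neq ?coinv_graft0l // => e; have := ltn_ord i; rewrite -e ltnNge nk.
by rewrite hat_of_neq // => e; move: nk; rewrite -e ltnNge leqW.
Qed.

Lemma hat_exp_one : hat_exp (hat_one PreLie) = exp_star.
Proof.
apply/functional_extensionality_dep => n; rewrite /hat_exp big_ord_recr /= big1 ?add0r;
  last first.
  move=> k _; rewrite graft_pow_one hat_of_neq ?scaler0 // => e.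
  by have := ltn_ord k; rewrite e ltnn.
by rewrite graft_pow_one hat_of_self.
Qed.

Lemma graft_pow_ext x x' k n : (forall i, (i <= n)%N -> x i = x' i) -> graft_pow x k n =
  graft_pow x' k n.
Proof.
elim: k n => [|k IH] n xx' /=; first exact: xx'.
apply: eq_bigr => i _; apply: eq_bigr => j _.
by rewrite xx' ?IH // => [l li|]; [apply: xx'; apply: leq_trans li _|]; rewrite -ltnS.
Qed.

(** In a product, both factors have a smaller arity than the result.  This is the
    triangularity of [hat_exp]. *)
Lemma graft_powS_ext x x' k n : (forall i, (i < n)%N -> x i = x' i) -> graft_pow x k.+1 n =
  graft_pow x' k.+1 n.
Proof.
move=> xx' /=; apply: eq_bigr => i _; apply: eq_bigr => j _.
have [jn|nj] := ltnP j n; last by rewrite !coinv_graft_lt //; right.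
have [i_n|ni] := ltnP i n; last by rewrite !coinv_graft_lt //; left.
by rewrite xx' // (@graft_pow_ext x x') // => l li; apply: xx'; apply: leq_ltn_trans li _.
Qed.

(** The part of [hat_exp] that only involves components of smaller arity. *)
Definition hat_exp_tail (x : hat PreLie) : hat PreLie := fun n =>
  \sum_(k < n) hat_exp_coef k.+1 *: graft_pow x k.+1 n.

Lemma hat_expE x n : hat_exp x n = x n + hat_exp_tail x n.
Proof. by rewrite /hat_exp big_ord_recl /hat_exp_coef /= invr1 scale1r. Qed.

Lemma hat_exp_tail_ext x x' n : (forall i, (i < n)%N -> x i = x' i) ->
  hat_exp_tail x n = hat_exp_tail x' n.
Proof. by move=> xx'; apply: eq_bigr => k _; rewrite (graft_powS_ext _ xx'). Qed.

Lemma hat_exp_inj : injective hat_exp.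
Proof.
move=> x x' e; apply/functional_extensionality_dep => n; elim/ltn_ind: n => n IH.
have := congr1 (fun z : hat PreLie => z n) e.
by rewrite !hat_expE (hat_exp_tail_ext IH) => /addIr.
Qed.

Section HexpSurjective.
Variable z : hat PreLie.

(** Solves [hat_exp x = z] in arities at most [j]. *)
Fixpoint hat_exp_approx (j : nat) : hat PreLie :=
  if j is j'.+1 then fun n => z n - hat_exp_tail (hat_exp_approx j') n else fun=> 0.

Lemma hat_exp_approxS j n :
  hat_exp_approx j.+1 n = z n - hat_exp_tail (hat_exp_approx j) n.
Proof. exact: erefl. Qed.

Lemma hat_exp_approx_stable j n : (n < j)%N -> hat_exp_approx j.+1 n = hat_exp_approx j n.
Proof.
elim: j n => [//|j IH] n nj; rewrite [LHS]hat_exp_approxS [RHS]hat_exp_approxS.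
rewrite (@hat_exp_tail_ext (hat_exp_approx j.+1) (hat_exp_approx j)); first exact: erefl.
by move=> i i_n; apply: IH; apply: leq_trans i_n _.
Qed.

Lemma hat_exp_approx_limit j n : (n < j)%N -> hat_exp_approx j n = hat_exp_approx n.+1 n.
Proof.
elim: j => [//|j IH]; rewrite ltnS leq_eqVlt => /predU1P [->|nj]; first exact: erefl.
by rewrite (hat_exp_approx_stable nj) (IH nj).
Qed.

Lemma hat_exp_surj : exists x, hat_exp x = z.
Proof.
exists (fun n => hat_exp_approx n.+1 n); apply/functional_extensionality_dep => n.
rewrite hat_expE hat_exp_approxS.
rewrite (@hat_exp_tail_ext (hat_exp_approx n) (fun n => hat_exp_approx n.+1 n));
  first exact: subrK.
by move=> i i_n; apply: hat_exp_approx_limit.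
Qed.

End HexpSurjective.

(** The solution [y] of [hat_exp y = hat_one PreLie] is the inverse: the first
    equation substitutes [y] in [hat_exp (hat_one PreLie)], and the second one
    follows from the injectivity of [hat_exp]. *)
Lemma exp_star_in_G : in_G exp_star.
Proof.
have [y ey] := hat_exp_surj (hat_one PreLie).
exists y; split.
  by rewrite -hat_exp_one hat_mul_hat_exp hat_mul_one.
apply: hat_exp_inj; rewrite -hat_mul_hat_exp ey hat_mul_one hat_exp_one //.
Qed.

Theorem proposition10 :
  [/\ in_G exp_star,
      G_Mu_corresponds (psi exp_star) 1%R expm1_over_x
    & forall log_star : hat PreLie, hat_inverse exp_star log_star ->
        G_Mu_corresponds (psi log_star) 1%R x_over_expm1].
Proof.
split; [exact: exp_star_in_G|exact: psi_exp_star|exact: psi_log_star].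
Qed.
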